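(* Let $n \geq 2$ be an integer and let $G$ be a finitely presented group. Then the $n$-fold tensor product $G^{\otimes n}$ is finitely presented if and only if $\gamma_n(G)$ is finitely presented.
   Context: Conventions: actions are on the right, $x^y = y^{-1}xy$, $[x,y]=x^{-1}y^{-1}xy = x^{-1}x^y$, and longer commutators are left-normed: $[x_1,\dots,x_k]=[[x_1,\dots,x_{k-1}],x_k]$. $\gamma_n(G)$ denotes the $n$-th term of the lower central series of $G$ ($\gamma_1(G)=G$, $\gamma_{k+1}(G)=[\gamma_k(G),G]$). Two groups $G$ and $H$, each acting on the other on the right and on itself by conjugation, act compatibly if for all $g,g_1\in G$, $h,h_1\in H$: $g^{(h^{g_1})} = ((g^{g_1^{-1}})^h)^{g_1}$ and $h^{(g^{h_1})} = ((h^{h_1^{-1}})^g)^{h_1}$. In that case the non-abelian tensor product $G\otimes H$ is the group generated by symbols $g\otimes h$ ($g\in G$, $h\in H$) subject to the relations $gg_1\otimes h = (g^{g_1}\otimes h^{g_1})(g_1\otimes h)$ and $g\otimes hh_1 = (g\otimes h_1)(g^{h_1}\otimes h^{h_1})$ for all $g,g_1\in G$, $h,h_1\in H$. The $n$-fold tensor product $G^{\otimes n}$ is defined inductively. $G^{\otimes 2}=G\otimes G$ is the non-abelian tensor product of $G$ with itself, all actions being conjugation. For $n\geq 3$, $G^{\otimes n} = G^{\otimes (n-1)}\otimes G$, where $G$ acts on $G^{\otimes (n-1)}$ diagonally, $(((g_1\otimes g_2)\otimes\dots)\otimes g_{n-1})^{g} = ((g_1^{g}\otimes g_2^{g})\otimes\dots)\otimes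 g_{n-1}^{g}$, and $G^{\otimes(n-1)}$ acts on $G$ by $g^{((g_2\otimes g_3)\otimes\dots)\otimes g_n} = g^{[g_2,g_3,\dots,g_n]}$. These actions are well defined and compatible. *)

(* Defs.v *)
From HB Require Import structures.
From mathcomp Require Import all_boot generic_quotient.
From mathcomp Require Import boolp classical_sets.

Set Implicit Arguments.
Unset Strict Implicit.
Unset Printing Implicit Defensive.

Local Open Scope group_scope.
Local Open Scope quotient_scope.
Local Open Scope classical_set_scope.

(* The letter [(x, b)] stands for x^-1 when [b] is true and for x otherwise. *)
Definition word (X : choiceType) := seq (X * bool).

Definition word_inv (X : choiceType) (w : word X) : word X :=
  rev [seq (l.1, ~~ l.2) | l <- w].

Definition word_eval (X : choiceType) (K : groupType) (f : X -> K)
    (w : word X) : K :=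
  \prod_(l <- w) (if l.2 then (f l.1)^-1 else f l.1).

(* A pair (u, v) in [R] is the defining relation u = v. *)
Inductive word_cong (X : choiceType) (R : set (word X * word X)) :
    word X -> word X -> Prop :=
| WordRefl u : word_cong R u u
| WordSym u v : word_cong R u v -> word_cong R v u
| WordTrans u v w : word_cong R u v -> word_cong R v w -> word_cong R u w
| WordCat u u' v v' :
    word_cong R u u' -> word_cong R v v' -> word_cong R (u ++ v) (u' ++ v')
| WordCancel x b : word_cong R [:: (x, b); (x, ~~ b)] [::]
| WordRel u v : R (u, v) -> word_cong R u v.

Section Presentation.
Variables (X : choiceType) (R : set (word X * word X)).
Implicit Types u v w : word X.

Definition word_congb : rel (word X) := fun u v => `[< word_cong R u v >].

Lemma word_congb_refl : reflexive word_congb.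
Proof. by move=> u; apply/asboolP; exact: WordRefl. Qed.
Lemma word_congb_sym : symmetric word_congb.
Proof. by move=> u v; apply/asboolP/asboolP; exact: WordSym. Qed.
Lemma word_congb_trans : transitive word_congb.
Proof.
by move=> v u w /asboolP uv /asboolP vw; apply/asboolP; exact: WordTrans uv vw.
Qed.

Canonical word_congb_equiv :=
  EquivRel word_congb word_congb_refl word_congb_sym word_congb_trans.

Definition presented : Type := {eq_quot word_congb}.
HB.instance Definition _ := Choice.on presented.

Definition pres_word u : presented := \pi_({eq_quot word_congb}) u.
Definition pres_repr (p : presented) : word X :=
  repr (p : {eq_quot word_congb}).
Definition pres_gen x : presented := pres_word [:: (x, false)].

Lemma pres_wordP u v : pres_word u = pres_word v <-> word_cong R u v.
Proof.
split=> [/eqP|uv]; first by rewrite eqmodE => /asboolP.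
by apply/eqP; rewrite eqmodE; apply/asboolP.
Qed.

Lemma pres_reprK p : pres_word (pres_repr p) = p.
Proof. exact: reprK. Qed.

Lemma pres_repr_cong u : word_cong R (pres_repr (pres_word u)) u.
Proof. by apply/pres_wordP; rewrite pres_reprK. Qed.

Lemma word_invl w : word_cong R (word_inv w ++ w) [::].
Proof.
elim: w => [|[x b] w IHw]; first exact: WordRefl.
apply: WordTrans IHw; rewrite /word_inv /= rev_cons -cats1 -catA.
apply: WordCat; first exact: WordRefl.
rewrite -[(x, b) :: w]cat1s catA -[X in word_cong R _ X]cat0s.
apply: WordCat; last exact: WordRefl.
by have := WordCancel R x (~~ b); rewrite negbK.
Qed.

Lemma word_invK : involutive (@word_inv X).
Proof.
move=> w; rewrite /word_inv map_rev revK -map_comp -[RHS]map_id.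
by apply: eq_map => -[x b] /=; rewrite negbK.
Qed.

Lemma word_invr w : word_cong R (w ++ word_inv w) [::].
Proof. by rewrite -{1}[w]word_invK; exact: word_invl. Qed.

Lemma word_inv_cong u v : word_cong R u v -> word_cong R (word_inv u) (word_inv v).
Proof.
move=> uv; apply: (@WordTrans _ _ _ (word_inv u ++ (v ++ word_inv v))).
  rewrite -{1}[word_inv u]cats0; apply: WordCat; first exact: WordRefl.
  exact/WordSym/word_invr.
rewrite catA -[X in word_cong R _ X]cat0s.
apply: WordCat; last exact: WordRefl.
apply: WordTrans (word_invl u); apply: WordCat; first exact: WordRefl.
exact: WordSym.
Qed.

Definition pres_mul (p q : presented) : presented :=
  pres_word (pres_repr p ++ pres_repr q).
Definition pres_one : presented := pres_word [::].
Definition pres_inv (p : presented) : presented :=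
  pres_word (word_inv (pres_repr p)).

Lemma pres_mulE u v : pres_mul (pres_word u) (pres_word v) = pres_word (u ++ v).
Proof. by apply/pres_wordP; apply: WordCat; exact: pres_repr_cong. Qed.

Lemma pres_invE u : pres_inv (pres_word u) = pres_word (word_inv u).
Proof. by apply/pres_wordP/word_inv_cong; exact: pres_repr_cong. Qed.

Lemma pres_mulA : associative pres_mul.
Proof.
move=> p q r; rewrite -[p]pres_reprK -[q]pres_reprK -[r]pres_reprK.
by rewrite !pres_mulE catA.
Qed.
Lemma pres_1mul : left_id pres_one pres_mul.
Proof. by move=> p; rewrite -[p]pres_reprK pres_mulE. Qed.
Lemma pres_mul1 : right_id pres_one pres_mul.
Proof. by move=> p; rewrite -[p]pres_reprK pres_mulE cats0. Qed.
Lemma pres_Vmul : left_inverse pres_one pres_inv pres_mul.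
Proof.
move=> p; rewrite -[p]pres_reprK pres_invE pres_mulE.
by apply/pres_wordP; exact: word_invl.
Qed.
Lemma pres_mulV : right_inverse pres_one pres_inv pres_mul.
Proof.
move=> p; rewrite -[p]pres_reprK pres_invE pres_mulE.
by apply/pres_wordP; exact: word_invr.
Qed.

HB.instance Definition _ := isGroup.Build presented
  pres_mulA pres_1mul pres_mul1 pres_Vmul pres_mulV.

Lemma pres_word_cat u v : pres_word (u ++ v) = pres_word u * pres_word v.
Proof. by rewrite -pres_mulE. Qed.

Lemma pres_word_inv u : pres_word (word_inv u) = (pres_word u)^-1.
Proof. by rewrite -pres_invE. Qed.

Lemma pres_word_eval u : pres_word u = word_eval pres_gen u.
Proof.
rewrite /word_eval; elim: u => [|[x b] u IHu]; first by rewrite big_nil.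
rewrite big_cons -IHu -cat1s pres_word_cat; congr (_ * _).
by case: b => //=; rewrite -pres_word_inv.
Qed.

Lemma pres_ind (P : presented -> Prop) :
    P 1 -> (forall p q, P p -> P q -> P (p * q)) ->
    (forall p, P p -> P p^-1) -> (forall x, P (pres_gen x)) ->
  forall p, P p.
Proof.
move=> P1 PM PV Pg p; rewrite -[p]pres_reprK pres_word_eval /word_eval.
by apply: big_ind => // -[x b] _ /=; case: b; [apply: PV|]; exact: Pg.
Qed.

Section Lift.
Variables (K : groupType) (f : X -> K).
Hypothesis fR : forall r, R r -> word_eval f r.1 = word_eval f r.2.

Lemma word_eval_cat u v : word_eval f (u ++ v) = word_eval f u * word_eval f v.
Proof. by rewrite /word_eval big_cat. Qed.

Lemma word_eval_cong u v : word_cong R u v -> word_eval f u = word_eval f v.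
Proof.
elim=> {u v} //.
- by move=> u v w _ -> _ ->.
- by move=> u u' v v' _ uE _ vE; rewrite !word_eval_cat uE vE.
- move=> x b; rewrite /word_eval !big_cons !big_nil /= mulg1.
  by case: b => /=; rewrite (mulgV, mulVg).
- by move=> u v /fR.
Qed.

Definition pres_lift (p : presented) : K := word_eval f (pres_repr p).

Lemma pres_lift_word u : pres_lift (pres_word u) = word_eval f u.
Proof. exact/word_eval_cong/pres_repr_cong. Qed.

Lemma pres_liftM : {morph pres_lift : p q / p * q}.
Proof.
move=> p q; rewrite -[p]pres_reprK -[q]pres_reprK -pres_word_cat.
by rewrite !pres_lift_word word_eval_cat.
Qed.

Lemma pres_lift_gen x : pres_lift (pres_gen x) = f x.
Proof. by rewrite pres_lift_word /word_eval big_cons big_nil /= mulg1. Qed.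
End Lift.
End Presentation.

Definition isomorphic (G H : groupType) : Prop :=
  exists f : {multiplicative G -> H}, bijective f.

Definition finitely_presented (G : groupType) : Prop :=
  exists (n : nat) (R : seq (word 'I_n * word 'I_n)),
    isomorphic (presented [set r | r \in R]) G.

Section Subgroups.
Variable G : groupType.

Definition is_subgroup (A : set G) : Prop :=
  A 1 /\ forall x y, A x -> A y -> A (x / y).

Definition generated (A : set G) : set G := smallest is_subgroup A.

Lemma generated_subgroup (A : set G) : is_subgroup (generated A).
Proof.
split=> [B [[B1 _] _] //|x y xA yA B BA].
by case: (BA) => -[_ BF] _; apply: BF; [exact: xA | exact: yA].
Qed.

Definition comm_subgroup (A B : set G) : set G :=
  generated [set z | exists x y, [/\ A x, B y & z = [~ x, y]]].

(* gamma_1 = G; the value at 0 is a dummy, also equal to G. *)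
Definition gamma_set (n : nat) : set G :=
  iter n.-1 (fun A => comm_subgroup A setT) setT.

Lemma gamma_subgroup n : is_subgroup (gamma_set n).
Proof. by rewrite /gamma_set; case: n.-1 => // k; exact: generated_subgroup. Qed.

Definition subgroup_type (A : set G) (_ : is_subgroup A) : Type :=
  {x : G | x \in A}.

Section SubgroupType.
Variables (A : set G) (sA : is_subgroup A).

HB.instance Definition _ := SubChoice.on (subgroup_type sA).

Lemma subgroup_closed : group_closed (fun x : G => x \in A).
Proof.
case: sA => A1 AF; split; first exact: mem_set.
by move=> x y; rewrite !unfold_in => /asboolP xA /asboolP yA; apply/asboolP/AF.
Qed.

HB.instance Definition _ :=
  SubChoice_isSubGroup.Build G _ (subgroup_type sA) subgroup_closed.
End SubgroupType.
End Subgroups.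

Definition gamma (G : groupType) (n : nat) : groupType :=
  subgroup_type (gamma_subgroup G n).

(* Right actions of a group A on a group X by automorphisms. *)
Record raction (A X : groupType) := RAction {
  ract :> X -> A -> X;
  ract1 : forall x, ract x 1 = x;
  ractM : forall x a b, ract x (a * b) = ract (ract x a) b;
  ract_morph : forall x y a, ract (x * y) a = ract x a * ract y a
}.

Section TensorDef.
Variables (G H : groupType).

(* [aG] is the action of H on G, and [aH] that of G on H. *)
Definition compatible (aG : raction H G) (aH : raction G H) : Prop :=
  (forall (g g1 : G) (h : H),
     aG g (aH h g1) = (aG (g ^ g1^-1) h) ^ g1) /\
  (forall (h h1 : H) (g : G),
     aH h (aG g h1) = (aH (h ^ h1^-1) g) ^ h1).

Definition tgen (g : G) (h : H) : word (G * H)%type := [:: ((g, h), false)].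

Definition tensor_rel (aG : raction H G) (aH : raction G H) :
    set (word (G * H)%type * word (G * H)%type) :=
  [set r | exists g g1 h,
     r = (tgen (g * g1) h, tgen (g ^ g1) (aH h g1) ++ tgen g1 h)] `|`
  [set r | exists g h h1,
     r = (tgen g (h * h1), tgen g h1 ++ tgen (aG g h1) (h ^ h1))].

Definition tensor (aG : raction H G) (aH : raction G H)
    (_ : compatible aG aH) : groupType :=
  presented (tensor_rel aG aH).
End TensorDef.

(* G^{(x) n} carries the diagonal action of G and the commutator map
   g_1 (x) ... (x) g_n |-> [g_1, ..., g_n], through which it acts on G; together
   they form a crossed module over G, and this is what makes the next
   pair of actions well defined and compatible. *)
Record crossed_module (G : groupType) := CrossedModule {
  xm_car : groupType;
  xm_act : raction G xm_car;
  xm_bd : {multiplicative xm_car -> G};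
  xm_equiv : forall t g, xm_bd (xm_act t g) = (xm_bd t) ^ g;
  xm_peiffer : forall t s, xm_act t (xm_bd s) = t ^ s
}.

Section Step.
Variables (G : groupType) (M : crossed_module G).
Let T := xm_car M.
Let act := xm_act M.
Let bd := xm_bd M.

Lemma bd1 : bd 1 = 1.
Proof. by apply: (mulgI (bd 1)); rewrite -gmulfM !mulg1. Qed.

Definition bd_act_fun (g : G) (t : T) : G := g ^ bd t.
Lemma bd_act1 g : bd_act_fun g 1 = g.
Proof. by rewrite /bd_act_fun bd1 conjg1. Qed.
Lemma bd_actM g t s : bd_act_fun g (t * s) = bd_act_fun (bd_act_fun g t) s.
Proof. by rewrite /bd_act_fun gmulfM conjgM. Qed.
Lemma bd_act_morph g h t : bd_act_fun (g * h) t = bd_act_fun g t * bd_act_fun h t.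
Proof. exact: conjMg. Qed.
Definition bd_act : raction T G := RAction bd_act1 bd_actM bd_act_morph.

Lemma bdV t : bd t^-1 = (bd t)^-1.
Proof. by apply: (mulgI (bd t)); rewrite -gmulfM !mulgV bd1. Qed.

Lemma step_compatible : compatible act bd_act.
Proof.
split=> [t s g|g h t]; rewrite /= /bd_act_fun.
  rewrite -!(xm_peiffer (c := M)) -/act -/bd -!ractM bdV.
  by congr (act _ _); rewrite conjgE.
by rewrite xm_equiv -!conjgM [bd t ^ h]conjgE.
Qed.

Definition tens : groupType := tensor step_compatible.
Definition elt (t : T) (g : G) : tens := pres_gen (tensor_rel act bd_act) (t, g).

Lemma eltMl t t1 g : elt (t * t1) g = elt (t ^ t1) (g ^ bd t1) * elt t1 g.
Proof.
rewrite /elt /pres_gen -pres_word_cat; apply/pres_wordP/WordRel; left.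
by exists t, t1, g.
Qed.

Lemma eltMr t g g1 : elt t (g * g1) = elt t g1 * elt (act t g1) (g ^ g1).
Proof.
rewrite /elt /pres_gen -pres_word_cat; apply/pres_wordP/WordRel; right.
by exists t, g, g1.
Qed.

Lemma word_eval_tgen (K : groupType) (f : T * G -> K) t g :
  word_eval f (tgen t g) = f (t, g).
Proof. by rewrite /word_eval big_cons big_nil /= mulg1. Qed.

Lemma step_lift_rel (K : groupType) (f : T * G -> K) :
    (forall t t1 g, f (t * t1, g) = f (t ^ t1, g ^ bd t1) * f (t1, g)) ->
    (forall t g g1, f (t, g * g1) = f (t, g1) * f (act t g1, g ^ g1)) ->
  forall r, tensor_rel act bd_act r -> word_eval f r.1 = word_eval f r.2.
Proof.
move=> fl fr r [] [a [b [c ->]]];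
  rewrite [LHS]word_eval_tgen [RHS]word_eval_cat !word_eval_tgen.
- exact: fl.
- exact: fr.
Qed.

Lemma actJ t s g : act (t ^ s) g = (act t g) ^ (act s g).
Proof. by rewrite -!(xm_peiffer (c := M)) -/act xm_equiv -!ractM conjgC. Qed.

Definition diag_gen (a : G) (p : T * G) : tens := elt (act p.1 a) (p.2 ^ a).

Lemma diag_rel a r :
  tensor_rel act bd_act r -> word_eval (diag_gen a) r.1 = word_eval (diag_gen a) r.2.
Proof.
apply: step_lift_rel => [t t1 g|t g g1]; rewrite /diag_gen /=.
  by rewrite ract_morph eltMl actJ xm_equiv -(conjJg g).
by rewrite conjMg eltMr -!ractM -(conjJg g) -conjgC.
Qed.

Definition diag_act_fun (x : tens) (a : G) : tens := pres_lift (diag_gen a) x.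

Lemma diag_act_elt t g a : diag_act_fun (elt t g) a = elt (act t a) (g ^ a).
Proof. exact: (pres_lift_gen (@diag_rel a)). Qed.

Lemma diag_act_morph x y a :
  diag_act_fun (x * y) a = diag_act_fun x a * diag_act_fun y a.
Proof. exact: (pres_liftM (@diag_rel a)). Qed.

Lemma morph1 (K L : groupType) (f : K -> L) :
  {morph f : x y / x * y} -> f 1 = 1.
Proof. by move=> fM; apply: (mulgI (f 1)); rewrite -fM !mulg1. Qed.

Lemma morphV (K L : groupType) (f : K -> L) :
  {morph f : x y / x * y} -> {morph f : x / x^-1}.
Proof.
by move=> fM x; apply: (mulgI (f x)); rewrite -fM !mulgV (morph1 fM).
Qed.

Lemma tens_ext (K : groupType) (f f' : tens -> K) :
    {morph f : x y / x * y} -> {morph f' : x y / x * y} ->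
    (forall t g, f (elt t g) = f' (elt t g)) -> forall x, f x = f' x.
Proof.
move=> fM fM' ff'; apply: pres_ind => [|x y fx fy|x fx|[t g]]; last exact: ff'.
- by rewrite !morph1.
- by rewrite fM fM' fx fy.
- by rewrite (morphV fM) (morphV fM') fx.
Qed.

Lemma diag_act1 x : diag_act_fun x 1 = x.
Proof.
move: x; apply: tens_ext => // [x y|t g]; first exact: diag_act_morph.
by rewrite diag_act_elt ract1 conjg1.
Qed.

Lemma diag_actM x a b :
  diag_act_fun x (a * b) = diag_act_fun (diag_act_fun x a) b.
Proof.
move: x; apply: tens_ext => [x y|x y|t g]; rewrite ?diag_act_morph //.
by rewrite !diag_act_elt ractM conjgM.
Qed.

Definition diag_act : raction G tens := RAction diag_act1 diag_actM diag_act_morph.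

Definition comm_gen (p : T * G) : G := [~ bd p.1, p.2].

Lemma comm_rel r :
  tensor_rel act bd_act r -> word_eval comm_gen r.1 = word_eval comm_gen r.2.
Proof.
apply: step_lift_rel => [t t1 g|t g g1]; rewrite /comm_gen /=.
  rewrite gmulfM -xm_peiffer xm_equiv -conjRg !commgEl.
  by rewrite !conjgE !invgM ?invgK -!mulgA !(mulKg, mulVKg, mulVg, mulgV, mulg1).
rewrite xm_equiv -conjRg !commgEl !conjgE !invgM.
by rewrite ?invgK -!mulgA !(mulKg, mulVKg, mulVg, mulgV, mulg1).
Qed.

Definition comm_map (x : tens) : G := pres_lift comm_gen x.

Lemma comm_map_morph : {morph comm_map : x y / x * y}.
Proof. exact: (pres_liftM comm_rel). Qed.

Lemma comm_map_elt t g : comm_map (elt t g) = [~ bd t, g].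
Proof. exact: (pres_lift_gen comm_rel). Qed.

HB.instance Definition _ :=
  isMultiplicative.Build tens G comm_map comm_map_morph.

Lemma comm_map_equiv x a : comm_map (diag_act x a) = (comm_map x) ^ a.
Proof.
move: x; apply: tens_ext => [x y|x y|t g] /=.
- by rewrite diag_act_morph comm_map_morph.
- by rewrite comm_map_morph conjMg.
- by rewrite diag_act_elt !comm_map_elt xm_equiv conjRg.
Qed.

Lemma elt_swap t g s h :
  diag_act (elt t g) (h * bd s) * elt s h = elt s h * diag_act (elt t g) (bd s * h).
Proof.
have l t' g' : elt (t' ^ s) (g' ^ bd s) = diag_act (elt t' g') (bd s).
  by rewrite /= diag_act_elt xm_peiffer.
have r t' g' : elt (act t' h) (g' ^ h) = diag_act (elt t' g') h.
  by rewrite /= diag_act_elt.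
have e1 : elt (t * s) (g * h) =
    diag_act (elt t h) (bd s) * diag_act (elt t g) (h * bd s) *
    (elt s h * diag_act (elt s g) h).
  by rewrite eltMl l eltMr ract_morph r -ractM [elt s _]eltMr r.
have e2 : elt (t * s) (g * h) =
    diag_act (elt t h) (bd s) * elt s h *
    (diag_act (elt t g) (bd s * h) * diag_act (elt s g) h).
  by rewrite eltMr r (eltMl _ _ h) (eltMl _ _ g) !l ract_morph -ractM.
have : diag_act (elt t h) (bd s) * diag_act (elt t g) (h * bd s) *
    (elt s h * diag_act (elt s g) h) = diag_act (elt t h) (bd s) * elt s h *
    (diag_act (elt t g) (bd s * h) * diag_act (elt s g) h).
  by rewrite -e1 e2.
by rewrite -!mulgA => /mulgI; rewrite !mulgA => /mulIg.
Qed.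

Lemma step_peiffer x y : diag_act x (comm_map y) = x ^ y.
Proof.
move: y x; apply: pres_ind => [|y z IHy IHz|y IHy|[s h]] x.
- by rewrite (morph1 comm_map_morph) ract1 conjg1.
- by rewrite comm_map_morph ractM IHy IHz conjgM.
- rewrite (morphV comm_map_morph) -[RHS](ract1 diag_act).
  rewrite -(mulgV (comm_map y)) ractM IHy conjgKV //.
- rewrite -/(elt s h) comm_map_elt; move: x.
  apply: tens_ext => [x y|x y|t g]; first exact: diag_act_morph.
    exact: conjMg.
  have := elt_swap (act t (h * bd s)^-1) (g ^ (h * bd s)^-1) s h.
  rewrite /= !diag_act_elt -!ractM -!conjgM mulVg ract1 conjg1 => sw.
  rewrite -[RHS]/((elt s h)^-1 * (elt t g * elt s h)) sw mulKg.
  by rewrite invgM commgEl conjgE !mulgA.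
Qed.

Definition tensor_step : crossed_module G :=
  @CrossedModule G tens diag_act comm_map comm_map_equiv step_peiffer.
End Step.

Section NFold.
Variable G : groupType.

Lemma conj_act1 (x : G) : x ^ 1 = x. Proof. exact: conjg1. Qed.
Lemma conj_actM (x a b : G) : x ^ (a * b) = (x ^ a) ^ b.
Proof. exact: conjgM. Qed.
Lemma conj_act_morph (x y a : G) : (x * y) ^ a = x ^ a * y ^ a.
Proof. exact: conjMg. Qed.
Definition conj_act : raction G G := RAction conj_act1 conj_actM conj_act_morph.

Definition conj_xm : crossed_module G :=
  @CrossedModule G G conj_act idfun (fun _ _ => erefl) (fun _ _ => erefl).

(* One factor: G acting on itself by conjugation, with the identity map; so
   the value at 2 is G (x) G with all actions by conjugation, and the value at
   0 is a dummy. *)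
Definition nfold_xm (n : nat) : crossed_module G :=
  iter n.-1 (@tensor_step G) conj_xm.

Lemma nfold_xmS n : nfold_xm n.+2 = tensor_step (nfold_xm n.+1).
Proof. by []. Qed.
End NFold.

Definition nfold_tensor (G : groupType) (n : nat) : groupType :=
  xm_car (nfold_xm G n).

(* Main.v *)
(* The kernel K_n(G) of the commutator map G^{(x)n} -> gamma_n(G) is central, by
   the Peiffer identity. It is finitely generated when G is finitely presented,
   and then both implications follow: gamma_n(G) is the quotient of G^{(x)n} by a
   finitely generated central subgroup, and a central extension of a finitely
   presented group by a finitely generated group is finitely presented.

   For F free of finite rank, K_n(F) is finitely generated by induction on n. On
   M (x) F, with M = F^{(x)(n-1)}, let d be the map m (x) g |-> m^-1 m^g; then
   x^-1 x^g = d(x) (x) g for all x. The image of K_n(F) under d lies in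
   K_{n-1}(F), and F acts trivially on the rest, K' = K_n(F) /\ ker d. As a
   subgroup of a free group is projective, the central extension K_n(F) splits
   off, so K' embeds in the abelianization of F^{(x)n}. The latter is a finitely
   generated module over the finitely generated nilpotent group F/gamma_n(F),
   hence noetherian by Hall's version of the basis theorem.

   For G = F/R, the elements of [R, F, ..., F] (n - 1 factors F) lift to elements
   of F^{(x)n} that die in G^{(x)n}. Hence K_n(G) is generated by the image of
   K_n(F) and by lifts of generators of R /\ gamma_n(F) modulo [R, F, ..., F], and
   R/[R, F, ..., F] is polycyclic because R is finitely generated as a normal
   subgroup. *)
Require Import Defs.
From mathcomp Require Import all_boot.
From HB Require Import structures.
From mathcomp Require Import boolp classical_sets.

Set Implicit Arguments.
Unset Strict Implicit.
Unset Printing Implicit Defensive.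

Local Open Scope group_scope.
Local Open Scope classical_set_scope.

(** * Generated subgroups *)

Section SubgroupTheory.
Variable G : groupType.
Implicit Types (A B H K N S : set G) (s : seq G) (x y t : G).

Lemma subgroupP A :
  A 1 -> (forall x y, A x -> A y -> A (x * y)) -> (forall x, A x -> A x^-1) ->
  is_subgroup A.
Proof. by move=> A1 AM AV; split=> // x y Ax Ay; apply: AM => //; apply: AV. Qed.

Lemma subgroup1 A : is_subgroup A -> A 1. Proof. by case. Qed.

Lemma subgroupV A x : is_subgroup A -> A x -> A x^-1.
Proof. by move=> [A1 AF] Ax; rewrite -[_^-1]mul1g; apply: AF. Qed.

Lemma subgroupM A x y : is_subgroup A -> A x -> A y -> A (x * y).
Proof.
by move=> sA Ax Ay; rewrite -[y]invgK; apply: sA.2 => //; apply: subgroupV.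
Qed.

Lemma subgroupX A x n : is_subgroup A -> A x -> A (x ^+ n).
Proof.
move=> sA Ax; elim: n => [|n IHn]; first exact: subgroup1.
by rewrite expgS; apply: subgroupM.
Qed.

Lemma subgroupMr A x y : is_subgroup A -> A y -> A (x * y) -> A x.
Proof. by move=> sA Ay Axy; rewrite -[x](mulgK y); apply: sA.2. Qed.

Lemma subgroupMl A x y : is_subgroup A -> A x -> A (x * y) -> A y.
Proof.
by move=> sA Ax Axy; rewrite -[y](mulKg x); apply: subgroupM => //; exact: subgroupV.
Qed.

Lemma trivial_subgroup : is_subgroup [set 1 : G].
Proof. by split=> // x y -> ->; rewrite /= mulgV. Qed.

Lemma subgroupI A B : is_subgroup A -> is_subgroup B -> is_subgroup (A `&` B).
Proof.
move=> sA sB; split=> [|x y [Ax Bx] [Ay By]]; first by split; exact: subgroup1.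
by split; [apply: sA.2 | apply: sB.2].
Qed.

Lemma sub_generated A : A `<=` generated A.
Proof. by move=> x Ax B [_ AB]; apply: AB. Qed.

Lemma generated_sub A B : is_subgroup B -> A `<=` B -> generated A `<=` B.
Proof. by move=> sB AB x; apply. Qed.

Lemma generatedS A B : A `<=` B -> generated A `<=` generated B.
Proof.
move=> AB; apply: generated_sub (generated_subgroup _) _ => x /AB.
exact: sub_generated.
Qed.

Lemma generated_id A : is_subgroup A -> generated A = A.
Proof.
by move=> sA; apply/seteqP; split; [apply: generated_sub | apply: sub_generated].
Qed.

Lemma generatedU A B : generated (generated A `|` B) = generated (A `|` B).
Proof.
apply/seteqP; split; apply: generated_sub (generated_subgroup _) _ => x [Ax|Bx].
- by apply: generatedS Ax; exact: subsetUl.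
- by apply: sub_generated; right.
- by apply: sub_generated; left; apply: sub_generated.
- by apply: sub_generated; right.
Qed.

Lemma generated_seq0 A : is_subgroup A -> generated (A `|` [set` [::]]) = A.
Proof.
move=> sA; rewrite (_ : [set` _] = set0) ?setU0 ?generated_id //.
by apply/seteqP; split.
Qed.

Lemma generated_cons A x s :
  generated (A `|` [set` x :: s]) = generated (generated (A `|` [set` s]) `|` [set x]).
Proof.
rewrite generatedU -setUA; congr (generated (_ `|` _)).
apply/seteqP; split=> y /=; rewrite inE.
  by case/orP=> [/eqP|]; [right | left].
by case=> [->|->]; rewrite ?eqxx ?orbT.
Qed.

Definition normalized_by H x := forall h, H h -> H (h ^ x) /\ H (h ^ x^-1).

Lemma normalized_byX H t n :
  normalized_by H t -> normalized_by H (t ^+ n).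
Proof.
move=> nH; elim: n => [|n IHn] h Hh; first by rewrite expg0 invg1 conjg1.
rewrite {1}expgSr expgS invgM !conjgM.
by split; [exact: (nH _ (IHn h Hh).1).1 | exact: (nH _ (IHn h Hh).2).2].
Qed.

Definition normal_set N := forall x y, N x -> N (x ^ y).

Lemma generated_normal A : normal_set A -> normal_set (generated A).
Proof.
move=> nA x y; move: x.
pose B := [set x | generated A (x ^ y)].
suff: generated A `<=` B by [].
apply: generated_sub => [|x Ax]; last by apply: sub_generated; apply: nA.
have sA := generated_subgroup A.
apply: subgroupP => [|x z|x] /=; rewrite /B /=.
- by rewrite conj1g; exact: subgroup1.
- by rewrite conjMg; apply: subgroupM.
- by rewrite conjVg; apply: subgroupV.
Qed.

(** The exponents are natural numbers, so negative powers of [t] need a second form. Inversion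
    exchanges the two forms, and conjugation by powers of [t] moves elements of [H] past them. *)
Lemma generated_normalizedP H t x :
  is_subgroup H -> normalized_by H t -> generated (H `|` [set t]) x ->
  exists h n, H h /\ (x = h * t ^+ n \/ x = t ^- n * h).
Proof.
move=> sH nH.
have nX n h := normalized_byX n nH (h := h).
pose P x := exists h n, H h /\ (x = h * t ^+ n \/ x = t ^- n * h).
have PV y : P y -> P y^-1.
  move=> [h [n [Hh [->|->]]]]; exists h^-1, n; rewrite invgM ?invgK.
    by split; [exact: subgroupV | right].
  by split; [exact: subgroupV | left].
have PH h n : H h -> P (t ^+ n * h).
  move=> Hh; exists (h ^ (t ^- n)), n; split; first exact: (nX n h Hh).2.
  by left; rewrite -conjgCV.
have PM y : P y -> P (y * t) /\ P (y * t^-1).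
  move=> [h [n [Hh [->|->]]]]; split.
  - by exists h, n.+1; split=> //; left; rewrite expgSr mulgA.
  - case: n => [|n].
      rewrite expg0 mulg1; exists (h ^ t^-1), 1%N; split; first exact: (nH h Hh).2.
      by right; rewrite expg1 conjgC conjgE invgK !mulgA mulVg mul1g.
    by exists h, n; split=> //; left; rewrite expgSr mulgA mulgK.
  - case: n => [|n].
      by rewrite expg0 invg1 mul1g; exists h, 1%N; split=> //; left.
    exists (h ^ t), n; split; first exact: (nH h Hh).1.
    by right; rewrite expgS invgM -!mulgA conjgE.
  - exists (h ^ t^-1), n.+1; split; first exact: (nH h Hh).2.
    by right; rewrite expgS invgM -!mulgA -conjgC.
have PMX y n : P y -> P (y * t ^+ n) /\ P (y * t ^- n).
  elim: n y => [|n IHn] y Py; first by rewrite expg0 invg1 mulg1.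
  split; first by rewrite expgS mulgA; exact: (IHn _ (PM y Py).1).1.
  by rewrite expgSr invgM mulgA; exact: (IHn _ (PM y Py).2).2.
move=> gx; suff sP : is_subgroup P.
  apply: (generated_sub sP _ gx) => y [Hy|->].
    by exists y, 0; split=> //; left; rewrite expg0 mulg1.
  by exists 1, 1%N; split; [exact: subgroup1 | left; rewrite mul1g].
apply: subgroupP => //.
  by exists 1, 0; split; [exact: subgroup1 | left; rewrite expg0 mulg1].
have PMH y h : P y -> H h -> P (y * h).
  move=> [k [n [Hk [->|->]]]] Hh.
    exists (k * h ^ (t ^- n)), n; split; last first.
      by left; rewrite -[LHS]mulgA -[RHS]mulgA -conjgCV.
    by apply: subgroupM => //; exact: (nX n h Hh).2.
  by exists (k * h), n; split; [exact: subgroupM | right; rewrite mulgA].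
move=> y _ Py [h [n [Hh [->|->]]]]; rewrite mulgA.
  exact: (PMX _ n (PMH _ _ Py Hh)).1.
exact: PMH (PMX _ n Py).2 Hh.
Qed.
End SubgroupTheory.

(** * Kernels and images of homomorphisms *)

Section Multiplicative.
Variables (K L : groupType) (f : {multiplicative K -> L}).

Lemma mult1 : f 1 = 1. Proof. exact: (morph1 (@gmulfM _ _ f)). Qed.
Lemma multV : {morph f : x / x^-1}. Proof. exact: (morphV (@gmulfM _ _ f)). Qed.
Lemma multF : {morph f : x y / x / y}. Proof. by move=> x y; rewrite gmulfM multV. Qed.
Lemma multJ : {morph f : x y / x ^ y}.
Proof. by move=> x y; rewrite !conjgE !gmulfM multV. Qed.
Lemma multR : {morph f : x y / [~ x, y]}.
Proof. by move=> x y; rewrite !commgEl gmulfM multV multJ. Qed.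
Lemma premult_subgroup (S : set L) : is_subgroup S -> is_subgroup [set x | S (f x)].
Proof.
move=> sS; split=> [|x y Sx Sy] /=; first by rewrite mult1; apply: subgroup1.
by rewrite multF; apply: sS.2.
Qed.

Lemma kernel_subgroup : is_subgroup [set x | f x = 1].
Proof. exact: (premult_subgroup (trivial_subgroup L)). Qed.

Lemma image_subgroup (A : set K) : is_subgroup A -> is_subgroup (f @` A).
Proof.
move=> sA; split=> [|_ _ [x Ax <-] [y Ay <-]].
  by exists 1; [exact: subgroup1 | exact: mult1].
by exists (x / y); [exact: sA.2 | exact: multF].
Qed.

Lemma range_subgroup : is_subgroup (range f).
Proof. by apply: image_subgroup; split. Qed.
End Multiplicative.

Lemma presented_subgroup (X : choiceType) (R : set (word X * word X))
    (S : set (presented R)) :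
  is_subgroup S -> (forall x, S (pres_gen R x)) -> forall p, S p.
Proof.
move=> sS Sgen; apply: pres_ind => // [|p q|p]; first exact: subgroup1.
  exact: subgroupM.
exact: subgroupV.
Qed.

(** * Relatively polycyclic subgroups *)

Section Polycyclic.
Variable G : groupType.
Implicit Types (A B C H K N S : set G) (s X : seq G) (x y t : G).

(** A subnormal series from [B] upwards with cyclic factors, each step adjoining one normalizing
    element. *)
Inductive polycyclic_over B : set G -> Prop :=
| PolycyclicRefl : polycyclic_over B B
| PolycyclicStep H t : polycyclic_over B H -> normalized_by H t ->
    polycyclic_over B (generated (H `|` [set t])).

Lemma polycyclic_subgroup B H :
  is_subgroup B -> polycyclic_over B H -> is_subgroup H.
Proof. by move=> sB [//|? ? _ _]; exact: generated_subgroup. Qed.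

Lemma polycyclic_sub B H : polycyclic_over B H -> B `<=` H.
Proof.
elim=> // K t _ BK _ x /BK Kx; apply: sub_generated; by left.
Qed.

Lemma polycyclic_trans A B C :
  polycyclic_over A B -> polycyclic_over B C -> polycyclic_over A C.
Proof. by move=> AB; elim=> // H t _ AH nH; apply: PolycyclicStep. Qed.

(** Induction along the series: to generators of the intersection of [S] with the smaller term [K]
    it is enough to add one element of [S], with the least positive exponent of [t]. *)
Lemma polycyclic_over_fingen B H S :
    is_subgroup B -> polycyclic_over B H -> is_subgroup S -> B `<=` S -> S `<=` H ->
  exists s, [set` s] `<=` S /\ S `<=` generated (B `|` [set` s]).
Proof.
move=> sB BH; elim: BH S => [|K t BK IHK nK] S sS BS SH.
  by exists [::]; split=> // x /SH Bx; apply: sub_generated; left.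
have sK := polycyclic_subgroup sB BK.
have [|x Bx|x []//|s [sS' SK]] := IHK (S `&` K); first exact: subgroupI.
  by split; [exact: BS | exact: polycyclic_sub BK _ Bx].
pose P n := `[< exists h, [/\ (0 < n)%N, K h & S (h * t ^+ n)] >].
have [g [Sg gP]] : exists g, S g /\ forall n h, K h -> S (h * t ^+ n) ->
    generated (B `|` [set` g :: s]) (h * t ^+ n).
  have SKg g n h : n = 0 -> K h -> S (h * t ^+ n) ->
      generated (B `|` [set` g :: s]) (h * t ^+ n).
    move=> ->; rewrite expg0 mulg1 => Kh Sh.
    by rewrite generated_cons; apply: sub_generated; left; apply: SK.
  have [/ex_minnP[d /asboolP[h0 [d_gt0 Kh0 Sh0]] dmin]|nP] :=
    pselect (exists n, P n); last first.
    (* No element of [S] has a positive exponent, so the extra generator can be 1. *)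
    exists 1; split=> [|[|n] h Kh Sh]; [exact: subgroup1 | exact: SKg |].
    by case: nP; exists n.+1; apply/asboolP; exists h.
  (* Division with remainder: by minimality [d] can be subtracted from any positive exponent, by
     cancelling one factor [h0 * t ^+ d]. *)
  exists (h0 * t ^+ d); split=> //; elim/ltn_ind=> -[|n] IHn h Kh Sh; first exact: SKg.
  have dn : (d <= n.+1)%N by apply: dmin; apply/asboolP; exists h.
  pose m := (n.+1 - d)%N; have nE : n.+1 = (m + d)%N by rewrite subnK.
  have hE : h * t ^+ n.+1 = h / h0 ^ t ^- m * t ^+ m * (h0 * t ^+ d).
    by rewrite nE expgnDr conjgE invgK !invgM invgK !mulgA !mulgVK.
  have Kh' : K (h / h0 ^ t ^- m).
    by apply: sK.2 => //; apply: (normalized_byX m nK Kh0).2.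
  rewrite hE in Sh *; have Sm := subgroupMr sS Sh0 Sh.
  have mn : (m < n.+1)%N by rewrite nE -{1}[m]addn0 ltn_add2l.
  apply: subgroupM (generated_subgroup _) (IHn m mn _ Kh' Sm) _.
  by apply: sub_generated; right; rewrite /= inE eqxx.
exists (g :: s); split=> [x /=|x Sx].
  by rewrite inE => /orP[/eqP->//|/sS' []].
have [h [n [Kh [xE|xE]]]] := generated_normalizedP sK nK (SH _ Sx).
  by rewrite xE; apply: gP; rewrite -?xE.
rewrite -[x]invgK; apply: subgroupV (generated_subgroup _) _.
rewrite xE invgM invgK; apply: gP; first exact: subgroupV.
by rewrite -[t ^+ n]invgK -invgM -xE; apply: subgroupV.
Qed.

(** The elements of [s] are adjoined one at a time; each normalizes what precedes because all
    commutators lie in [B]. *)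
Lemma polycyclic_abelian B s : is_subgroup B ->
    (forall x y, generated (B `|` [set` s]) x -> generated (B `|` [set` s]) y ->
       B [~ x, y]) ->
  polycyclic_over B (generated (B `|` [set` s])).
Proof.
move=> sB; elim: s => [|t s IHs] Bcomm.
  by rewrite generated_seq0 //; apply: PolycyclicRefl.
have sC := generated_subgroup (B `|` [set` t :: s]).
have sub : generated (B `|` [set` s]) `<=` generated (B `|` [set` t :: s]).
  by apply: generatedS => x [Bx|sx]; [left | right; rewrite /= inE [x \in s]sx orbT].
have Ct : generated (B `|` [set` t :: s]) t.
  by apply: sub_generated; right; rewrite /= inE eqxx.
rewrite generated_cons; apply: PolycyclicStep.
  by apply: IHs => x y Cx Cy; apply: Bcomm; apply: sub.
have nH h x : generated (B `|` [set` s]) h -> generated (B `|` [set` t :: s]) x ->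
    generated (B `|` [set` s]) (h ^ x).
  move=> Hh Cx; rewrite -[h ^ x](mulVKg h) -commgEl.
  apply: (subgroupM (generated_subgroup _) Hh); apply: sub_generated; left.
  by apply: Bcomm => //; apply: sub.
by move=> h Hh; split; apply: nH => //; apply: (subgroupV sC).
Qed.

(** * Iterated commutators of a normal subgroup with the whole group *)

Lemma comm_subgroup_normal N : normal_set N -> normal_set (comm_subgroup N setT).
Proof.
move=> nN; apply: generated_normal => _ y [x [f [Nx _ ->]]].
by exists (x ^ y), (f ^ y); rewrite conjRg; split=> //; apply: nN.
Qed.

Lemma mem_comm N x y : N x -> comm_subgroup N setT [~ x, y].
Proof. by move=> Nx; apply: sub_generated; exists x, y. Qed.

Lemma comm_subgroup_sub N :
  is_subgroup N -> normal_set N -> comm_subgroup N setT `<=` N.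
Proof.
move=> sN nN; apply: generated_sub => // _ [x [f [Nx _ ->]]].
by rewrite commgEl; apply: subgroupM (subgroupV _ _) (nN _ _ _).
Qed.

(** The subgroup [J] lies between [[[N, G], G]] and [[N, G]], hence is normal. Membership of a
    commutator in [J] is therefore preserved by products and inverses in either argument, and it can
    be tested on generators. *)
Lemma comm_fingen X N s :
    generated [set` X] = setT -> is_subgroup N -> normal_set N ->
    N = generated (comm_subgroup N setT `|` [set` s]) ->
  comm_subgroup N setT = generated (comm_subgroup (comm_subgroup N setT) setT
    `|` [set` [seq [~ y, x] | y <- s, x <- X]]).
Proof.
move=> genX sN nN NE; set N' := comm_subgroup N setT; set J := generated _.
have sN' : is_subgroup N' := generated_subgroup _.
have nN' : normal_set N' := comm_subgroup_normal nN.
have sJ : is_subgroup J := generated_subgroup _.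
have JN' : J `<=` N'.
  apply: generated_sub => // x [/comm_subgroup_sub|/allpairsP[[y f] [ys _ ->]]].
    exact.
  by apply: mem_comm; rewrite NE; apply: sub_generated; right.
have CJ x y : N' x -> J [~ x, y].
  by move=> N'x; apply: sub_generated; left; apply: mem_comm.
have nJ : normal_set J.
  move=> x y Jx; rewrite -[x ^ y](mulVKg x) -commgEl.
  by apply: (subgroupM sJ Jx); apply: CJ; apply: JN'.
have commJM x y z : J [~ x, z] -> J [~ y, z] -> J [~ x * y, z].
  move=> Jx Jy; suff -> : [~ x * y, z] = [~ x, z] ^ y * [~ y, z].
    by apply: (subgroupM sJ _ Jy); apply: nJ.
  by rewrite !commgEl (conjgE (_ * _) y) conjMg invgM !mulgA !mulgK.
have commJV x z : J [~ x, z] -> J [~ x^-1, z].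
  move=> Jx; suff -> : [~ x^-1, z] = [~ x, z]^-1 ^ x^-1.
    by apply: nJ; apply: (subgroupV sJ).
  by rewrite !commgEl [RHS]conjgE invgM conjVg !invgK !mulgA !mulgK.
have commJsym x z : J [~ x, z] -> J [~ z, x].
  by rewrite -invgR => Jx; rewrite -[X in J X]invgK; apply: (subgroupV sJ).
have sub1 z : is_subgroup [set x | J [~ x, z]].
  apply: subgroupP => [|x y|x] /=; [|exact: commJM|exact: commJV].
  by rewrite comm1g; apply: subgroup1.
have sub2 z : is_subgroup [set x | J [~ z, x]].
  apply: subgroupP => [|x y|x] /=.
  - by rewrite commg1; apply: subgroup1.
  - by move=> /commJsym Jx /commJsym Jy; apply: commJsym; apply: commJM.
  - by move=> /commJsym Jx; apply: commJsym; apply: commJV.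
apply/seteqP; split=> //; apply: generated_sub => // _ [x [f [Nx _ ->]]].
rewrite NE in Nx; apply: generated_sub (sub1 f) _ _ Nx => y [/CJ-/(_ f)//|ys] /=.
have : generated [set` X] f by rewrite genX.
apply: generated_sub (sub2 y) _ _ => z zX; apply: sub_generated; right.
by apply/allpairsP; exists (y, z).
Qed.

(** [[N, G, ..., G]] with [k] factors [G]; for [N = setT] this is the term of index [k.+1] of the
    lower central series. *)
Definition lower_series N k := iter k (fun A => comm_subgroup A setT) N.

Lemma lower_series_subgroup N k : is_subgroup N -> is_subgroup (lower_series N k).
Proof. by case: k => // k _; exact: generated_subgroup. Qed.

Lemma lower_series_normal N k : normal_set N -> normal_set (lower_series N k).
Proof. by move=> nN; elim: k => //= k IHk; exact: comm_subgroup_normal. Qed.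

(** Each term is central modulo the next. The induction carries along finitely many generators of
    each term modulo the next, supplied by [comm_fingen]. *)
Lemma polycyclic_lower_series X N s k :
    generated [set` X] = setT -> is_subgroup N -> normal_set N ->
    N = generated (comm_subgroup N setT `|` [set` s]) ->
  polycyclic_over (lower_series N k) N.
Proof.
move=> genX sN nN NE.
suff [] : polycyclic_over (lower_series N k) N /\ exists s' : seq G,
  lower_series N k = generated (lower_series N k.+1 `|` [set` s']) by [].
elim: k => [|k [IHk [s' NkE]]]; first by split; [exact: PolycyclicRefl | exists s].
have sNk := lower_series_subgroup k sN; have nNk := lower_series_normal (k := k) nN.
split; last by eexists; apply: comm_fingen genX sNk nNk NkE.
apply: polycyclic_trans IHk; rewrite [X in polycyclic_over _ X]NkE.
apply: polycyclic_abelian; first exact: generated_subgroup.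
by move=> x y; rewrite -NkE => Nx _; apply: mem_comm.
Qed.

Definition fingen S := exists s, S = generated [set` s].

Lemma fingenP S s : is_subgroup S -> [set` s] `<=` S -> S `<=` generated [set` s] ->
  fingen S.
Proof.
by move=> sS sSs Ss; exists s; apply/seteqP; split=> //; apply: generated_sub.
Qed.

Lemma fingen_sub_abelian A S :
    fingen A -> (forall x y, A x -> A y -> x * y = y * x) ->
  is_subgroup S -> S `<=` A -> fingen S.
Proof.
move=> [s AE] commA sS SA.
have s1 := trivial_subgroup G.
have unit1 s' : generated ([set 1] `|` [set` s']) = generated [set` s'].
  have sG := generated_subgroup [set` s'].
  apply/seteqP; split; last by apply: generatedS; apply: subsetUr.
  by apply: generated_sub => // x [->|]; [exact: subgroup1 | exact: sub_generated].
have pA : polycyclic_over [set 1] A.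
  rewrite AE -unit1; apply: polycyclic_abelian => // x y; rewrite unit1 -AE => Ax Ay.
  by apply/eqP/commgP; apply: commA.
have [|s' [sS' Ss']] := polycyclic_over_fingen s1 pA sS _ SA.
  by move=> _ ->; apply: subgroup1.
by rewrite unit1 in Ss'; apply: fingenP Ss'.
Qed.

End Polycyclic.

(** * Noetherian modules *)

Section Noetherian.
Variables (F V : groupType) (act : raction F V).
Implicit Types (A S W : set V) (H : set F) (s : seq V) (x y v w : V) (h t : F).

Lemma act_id h : act 1 h = 1.
Proof. exact: (morph1 (fun x y => ract_morph act x y h)). Qed.

Lemma act_inv x h : act x^-1 h = (act x h)^-1.
Proof. exact: (morphV (fun x y => ract_morph act x y h)). Qed.

Lemma actK h : cancel (act^~ h) (act^~ h^-1).
Proof. by move=> x; rewrite -ractM mulgV ract1. Qed.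

Definition act_invariant H S := forall x h, H h -> S x -> S (act x h).

Definition act_span H A := smallest (fun S => is_subgroup S /\ act_invariant H S) A.

Lemma act_span_subgroup H A : is_subgroup (act_span H A).
Proof.
split=> [B [[[B1 _] _] _] //|x y xA yA B BA].
by have [[[_ BF] _] _] := BA; apply: BF; [exact: xA | exact: yA].
Qed.

Lemma act_span_invariant H A : act_invariant H (act_span H A).
Proof.
move=> x h Hh xA B BA; have [[_ iB] _] := BA; apply: (iB _ _ Hh); exact: xA.
Qed.

Lemma sub_act_span H A : A `<=` act_span H A.
Proof. by move=> x Ax B [_ AB]; apply: AB. Qed.

Lemma act_span_sub H A S :
  is_subgroup S -> act_invariant H S -> A `<=` S -> act_span H A `<=` S.
Proof. by move=> sS iS AS x; apply. Qed.

Lemma act_spanS H A A' : A `<=` A' -> act_span H A `<=` act_span H A'.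
Proof.
move=> AA'; apply: act_span_sub; [exact: act_span_subgroup| |].
  exact: act_span_invariant.
by move=> x /AA'; apply: sub_act_span.
Qed.

Lemma act_invariantW H H' S : H `<=` H' -> act_invariant H' S -> act_invariant H S.
Proof. by move=> HH' iS x h /HH'; apply: iS. Qed.

Lemma act_invariant_generated H S :
    (forall x h, H h -> S x -> S (act x h) /\ S (act x h^-1)) ->
  act_invariant (generated H) S.
Proof.
move=> iS x h gh; move: x.
suff sK : is_subgroup [set h | forall x, S x -> S (act x h) /\ S (act x h^-1)].
  have gK := generated_sub sK (fun h Hh x => iS x h Hh) gh.
  by move=> x Sx; apply: (gK x Sx).1.
apply: subgroupP => [x Sx|g k Kg Kk x Sx|g Kg x Sx] /=.
- by rewrite invg1 ract1.
- rewrite invgM !ractM; split; first exact: (Kk _ (Kg _ Sx).1).1.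
  exact: (Kg _ (Kk _ Sx).2).2.
- by rewrite invgK; have [] := Kg x Sx.
Qed.

Definition noetherian H W := forall S,
  is_subgroup S -> act_invariant H S -> S `<=` W ->
  exists s, [set` s] `<=` S /\ S `<=` act_span H [set` s].

Hypothesis mulC : forall x y, x * y = y * x.

Lemma mulACA x y v w : x * y * (v * w) = x * v * (y * w).
Proof. by rewrite !mulgA -(mulgA x) (mulC y) mulgA. Qed.

(** * The basis theorem for one additional operator [t] *)

Section Extension.
Variables (H : set F) (t : F) (W : set V).
Hypotheses (sH : is_subgroup H) (nH : normalized_by H t).
Hypotheses (sW : is_subgroup W) (iW : act_invariant H W).

(* Polynomials of degree < k in t with coefficients in W. *)
Fixpoint below k : set V :=
  if k is k'.+1 then
    [set x | exists w v, [/\ below k' w, W v & x = w * act v (t ^+ k')]]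
  else [set 1].

Lemma below_subgroup k : is_subgroup (below k).
Proof.
elim: k => [|k IHk] /=; first exact: trivial_subgroup.
apply: subgroupP => [|x y [w [v [Bw Wv ->]]] [w' [v' [Bw' Wv' ->]]]|x [w [v [Bw Wv ->]]]].
- exists 1, 1; rewrite act_id mulg1; split=> //; exact: subgroup1.
- exists (w * w'), (v * v'); rewrite ract_morph mulACA.
  by split=> //; apply: subgroupM.
- exists w^-1, v^-1; rewrite act_inv invgM mulC.
  by split=> //; apply: subgroupV.
Qed.

Lemma below_invariant k : act_invariant H (below k).
Proof.
elim: k => [|k IHk] x h Hh /=; first by move=> ->; rewrite /= act_id.
move=> [w [v [Bw Wv ->]]]; exists (act w h), (act v (h ^ t ^- k)).
rewrite ract_morph -!ractM -conjgCV; split=> //; first exact: IHk.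
by apply: iW => //; apply: (normalized_byX k nH Hh).2.
Qed.

Lemma belowS k : below k `<=` below k.+1.
Proof.
by move=> x Bx; exists x, 1; rewrite act_id mulg1; split=> //; apply: subgroup1.
Qed.

Lemma below_act k x : below k x -> below k.+1 (act x t).
Proof.
elim: k x => [|k IHk] x.
  by move=> ->; rewrite act_id; apply: subgroup1; apply: below_subgroup.
move=> [w [v [/IHk Bw Wv ->]]]; exists (act w t), v.
by rewrite ract_morph -ractM expgSr.
Qed.

(** Coefficients of [t ^+ k] in elements of [S] of degree at most [k]. An element of [V] may have
    several such expressions, and all of them count. *)
Definition lead S k : set V :=
  [set v | W v /\ exists w, below k w /\ S (w * act v (t ^+ k))].

Lemma lead_subgroup S k : is_subgroup S -> is_subgroup (lead S k).
Proof.
move=> sS; have sB := below_subgroup k.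
apply: subgroupP => [|x y [Wx [w [Bw Sw]]] [Wy [z [Bz Sz]]]|x [Wx [w [Bw Sw]]]].
- split; first exact: subgroup1.
  by exists 1; rewrite act_id mulg1; split; apply: subgroup1.
- split; first exact: subgroupM.
  by exists (w * z); rewrite ract_morph mulACA; split; apply: subgroupM.
- split; first exact: subgroupV.
  by exists w^-1; rewrite act_inv mulC -invgM; split; apply: subgroupV.
Qed.

Lemma lead_invariant S k : act_invariant H S -> act_invariant H (lead S k).
Proof.
move=> iS v h Hh [Wv [w [Bw Sw]]]; split; first exact: iW.
have Hh' : H (h ^ t ^+ k) by apply: (normalized_byX k nH Hh).1.
exists (act w (h ^ t ^+ k)); split; first exact: below_invariant.
by rewrite -ractM (conjgC h) ractM -ract_morph; apply: iS.
Qed.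

(** Acting by [t] raises the degree and keeps the leading coefficient. *)
Lemma leadS S k m :
  (forall x, S x -> S (act x t)) -> (k <= m)%N -> lead S k `<=` lead S m.
Proof.
move=> St /subnK <-; elim: (m - k)%N => [|i IHi] v //.
move=> /IHi[Wv [w [Bw Sw]]]; split=> //; exists (act w t); split.
  exact: below_act.
by rewrite addSn expgSr ractM -ract_morph; apply: St.
Qed.

Let H' := generated (H `|` [set t]).

(** Induction on the degree: dividing by an element of the span with the same leading coefficient
    leaves an element of [S] of lower degree. *)
Lemma below_span S s :
    is_subgroup S -> [set` s] `<=` S -> act_invariant H' S ->
    (forall k, lead S k `<=` lead (act_span H' [set` s]) k) ->
  forall k, S `&` below k `<=` act_span H' [set` s].
Proof.
move=> sS sSs iS leadE; have sP := act_span_subgroup H' [set` s].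
elim=> [|k IHk] x [Sx]; first by move=> /= ->; apply: subgroup1.
move=> /= [w [v [Bw Wv xE]]].
have [|_ [w' [Bw' Pw']]] := leadE k v; first by split=> //; exists w; rewrite -xE.
have xE' : x = w / w' * (w' * act v (t ^+ k)) by rewrite mulgA mulgVK.
rewrite xE'; apply: (subgroupM sP) => //; apply: IHk; split.
  apply: (subgroupMr sS _ (y := w' * act v (t ^+ k))); last by rewrite -xE'.
  exact: (act_span_sub sS iS sSs).
by have sB := below_subgroup k; apply: sB.2.
Qed.

Lemma lead_fingen S k : noetherian H W -> is_subgroup S -> act_invariant H S ->
  exists s, [set` s] `<=` S /\ lead S k `<=` lead (act_span H' [set` s]) k.
Proof.
move=> noeW sS iS.
have [||v [] //|s [sL Ls]] := noeW (lead S k).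
- exact: lead_subgroup.
- exact: lead_invariant.
(* For each leading coefficient [v], [f v] is the lower part of an element of [S]; outside
   [lead S k] its value is arbitrary. *)
have [f fP] : exists f : V -> V, forall v, lead S k v ->
    below k (f v) /\ S (f v * act v (t ^+ k)).
  suff /choice[f fP] v : exists w, lead S k v -> below k w /\ S (w * act v (t ^+ k)).
    by exists f.
  have [[_ [w ?]]|nL] := pselect (lead S k v); first by exists w.
  by exists 1.
exists [seq f v * act v (t ^+ k) | v <- s]; split.
  by move=> _ /= /mapP[v /sL/fP[_ Sv] ->].
move=> v /Ls; apply: act_span_sub; first exact/lead_subgroup/act_span_subgroup.
  apply: lead_invariant; apply: act_invariantW; last exact: act_span_invariant.
  by move=> h Hh; apply: sub_generated; left.
move=> x sx; have Lx := sL _ sx; split; first by have [] := Lx.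
exists (f x); split; first by have [] := fP _ Lx.
by apply: sub_act_span; apply/mapP; exists x.
Qed.

(** The sets [lead S k] increase with [k], so their union is a submodule of [W]. Its finitely many
    generators already occur at one stage. *)
Lemma lead_stable S : noetherian H W -> is_subgroup S -> act_invariant H' S ->
  exists k0, forall k, lead S k `<=` lead S k0.
Proof.
move=> noeW sS iS.
have Ht : H' t by apply: sub_generated; right.
have HH' : H `<=` H' by move=> h Hh; apply: sub_generated; left.
have iSH := act_invariantW HH' iS.
have St x : S x -> S (act x t) by exact: iS.
pose L := [set v | exists k, lead S k v].
have sL : is_subgroup L.
  apply: subgroupP => [|x y [k Lx] [m Ly]|x [k Lx]].
  - by exists 0; apply: subgroup1; apply: lead_subgroup.
  - exists (maxn k m); apply: (subgroupM (lead_subgroup _ sS)).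
      by apply: leadS Lx; rewrite // leq_maxl.
    by apply: leadS Ly; rewrite // leq_maxr.
  - by exists k; apply: subgroupV => //; apply: lead_subgroup.
have [|v [k []] //|s [Ls sL']] := noeW L sL.
  by move=> v h Hh [k Lv]; exists k; apply: lead_invariant.
have [k0 k0P] : exists k0, [set` s] `<=` lead S k0.
  elim: s Ls {sL'} => [|x s IHs] Ls; first by exists 0.
  have [y ys|k sk] := IHs; first by apply: Ls; rewrite /= inE [y \in s]ys orbT.
  have [m Lm] : L x by apply: Ls; rewrite /= inE eqxx.
  exists (maxn k m) => y; rewrite /= inE => /orP[/eqP->|/sk].
    by apply: leadS Lm; rewrite // leq_maxr.
  by apply: leadS; rewrite // leq_maxl.
exists k0 => k v Lv; have /sL' Pv : L v by exists k.
by apply: (act_span_sub _ _ k0P Pv); [exact: lead_subgroup | exact: lead_invariant].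
Qed.

(* Hilbert's basis theorem, with leading coefficients of Laurent polynomials in
   t twisted by conjugation. *)
Lemma noetherian_step : noetherian H W -> noetherian H' (act_span H' W).
Proof.
move=> noeW S sS iS SW.
have sH' : is_subgroup H' := generated_subgroup _.
have Ht : H' t by apply: sub_generated; right.
have HtV : H' t^-1 by apply: (subgroupV sH').
have HH' : H `<=` H' by move=> h Hh; apply: sub_generated; left.
have iSH := act_invariantW HH' iS.
have [k0 k0P] := lead_stable noeW sS iS.
(* One finite list for each degree up to [k0], concatenated. *)
have [s [sSs leads]] : exists s, [set` s] `<=` S /\
    forall k, (k <= k0)%N -> lead S k `<=` lead (act_span H' [set` s]) k.
  elim: {k0P} k0 => [|k [s [sSs leads]]].
    have [s [sSs leads]] := lead_fingen 0 noeW sS iSH.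
    by exists s; split=> // k; rewrite leqn0 => /eqP->.
  have [s' [sSs' leads']] := lead_fingen k.+1 noeW sS iSH.
  exists (s ++ s'); split=> [x /=|m].
    by rewrite mem_cat => /orP[/sSs|/sSs'].
  have lead_sub (r : seq V) : [set` r] `<=` [set` s ++ s'] ->
      lead (act_span H' [set` r]) m `<=` lead (act_span H' [set` s ++ s']) m.
    move=> rs v [Wv [w [Bw Sw]]]; split=> //; exists w; split=> //.
    exact: act_spanS Sw.
  rewrite leq_eqVlt => /orP[/eqP mE|mk] v.
    rewrite {}mE in lead_sub * => /leads'; apply: lead_sub => x /=.
    by rewrite mem_cat orbC => ->.
  by move=> /(leads _ mk); apply: lead_sub => x /=; rewrite mem_cat => ->.
exists s; split=> // x Sx.
(* Beyond [k0] the leading coefficients are those of degree [k0], raised by powers of [t]. *)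
have leadE k : lead S k `<=` lead (act_span H' [set` s]) k.
  have [/leads //|/ltnW k0k v /k0P/(leads _ (leqnn _))] := leqP k k0.
  by apply: leadS => // y; apply: act_span_invariant.
(* A power of [t] clears the negative exponents of a Laurent polynomial. *)
have [n [k Bx]] : exists n k, below k (act x (t ^+ n)).
  have Bup y n k i : below k (act y (t ^+ n)) -> below (i + k) (act y (t ^+ (i + n))).
    by move=> By; elim: i => // i IHi; rewrite !addSn expgSr ractM; apply: below_act.
  have Bleq y k i : below k y -> below (i + k) y.
    by move=> By; elim: i => // i IHi; apply: belowS.
  pose U := [set y | exists n k, below k (act y (t ^+ n))].
  suff [sU iU] : is_subgroup U /\ act_invariant H' U.
    (* An element of [W] is a constant, and constants are the polynomials of degree below 1. *)
    apply: (act_span_sub sU iU _ (SW _ Sx)) => v Wv; exists 0, 1%N.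
    exists 1, v; rewrite mul1g expg0 !ract1; by split.
  split.
    apply: subgroupP => [|y z [n [k By]] [m [i Bz]]|y [n [k By]]].
    - by exists 0, 0; rewrite act_id.
    - have sB := below_subgroup (n + i + (m + k)).
      exists (m + n)%N, (n + i + (m + k))%N; rewrite ract_morph; apply: (subgroupM sB).
        exact/Bleq/Bup.
      by rewrite addnC [(m + n)%N]addnC; apply/Bleq/Bup.
    - exists n, k; rewrite act_inv; exact: (subgroupV (below_subgroup k)).
  apply: act_invariant_generated => y h; case=> [Hh|->] [n [k By]]; last first.
    split; first by exists n, k.+1; rewrite -ractM -expgS expgSr ractM; apply: below_act.
    by exists n.+1, k; rewrite -ractM expgS mulKg.
  have comm g : H g -> exists n k, below k (act (act y g) (t ^+ n)).
    move=> Hg; exists n, k; rewrite -ractM (conjgC g) ractM; apply: below_invariant => //.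
    exact: (normalized_byX n nH Hg).1.
  by split; apply: comm => //; apply: subgroupV.
rewrite -[x](actK (t ^+ n)); apply: act_span_invariant.
  by apply: (subgroupV sH'); apply: (subgroupX _ sH').
apply: (below_span sS sSs iS leadE (k := k)); split=> //; apply: iS => //.
exact: (subgroupX _ sH').
Qed.
End Extension.

(** Induction along the series. At the bottom [B] acts trivially, so submodules are subgroups of a
    finitely generated abelian group; each further step is [noetherian_step]. *)
Lemma noetherian_polycyclic (B H : set F) s :
    is_subgroup B -> (forall x h, B h -> act x h = x) -> polycyclic_over B H ->
  noetherian H (act_span H [set` s]).
Proof.
move=> sB trivB; elim=> {H} [|H t BH IHH nH].
  have spanE A : act_span B A = generated A.
    have sG := generated_subgroup A.
    apply/seteqP; split; last first.
      exact: (generated_sub (act_span_subgroup _ _) (@sub_act_span _ _)).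
    by apply: (act_span_sub sG _ (@sub_generated _ A)) => x h Bh; rewrite trivB.
  move=> S sS iS SW; rewrite spanE in SW.
  have [||s' SE] := fingen_sub_abelian _ _ sS SW; first by exists s.
    by move=> x y _ _; apply: mulC.
  by exists s'; rewrite spanE -SE; split=> //; rewrite SE; apply: sub_generated.
set H' := generated _.
have sH := polycyclic_subgroup sB BH.
have HH' : H `<=` H' by move=> h Hh; apply: sub_generated; left.
have spanE : act_span H' [set` s] = act_span H' (act_span H [set` s]).
  apply/seteqP; split.
    by apply: act_spanS; apply: sub_act_span.
  apply: act_span_sub; [exact: act_span_subgroup | exact: act_span_invariant |].
  apply: act_span_sub; [exact: act_span_subgroup | | exact: sub_act_span].
  exact: (act_invariantW HH' (@act_span_invariant _ _)).
rewrite spanE; apply: noetherian_step => //; first exact: act_span_subgroup.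
exact: act_span_invariant.
Qed.
End Noetherian.

(** * Projectivity of subgroups of free groups *)

Definition free (X : choiceType) : groupType :=
  presented (@set0 (word X * word X)).

Section FreeSection.
Variables (X : choiceType) (M : groupType) (b : {multiplicative M -> free X}).
Implicit Types (u w : word X) (q f : free X) (m : M).

Let coset q : set (free X) := [set f | exists m, f = b m * q].
(** A transversal of the right cosets of the image of [b]. The default is never reached, as [q] lies
    in its own coset; [tau 1] need not be 1. *)
Let tau q : free X := xget 1 (coset q).
Let letter (l : X * bool) : free X := pres_word _ [:: l].

Lemma tau_coset q : exists m, tau q = b m * q.
Proof.
have [|m tauE] := @xgetPex _ 1 (coset q); last by exists m.
by exists q, 1; rewrite mult1 mul1g.
Qed.

Lemma tauM m q : tau (b m * q) = tau q.
Proof.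
congr xget; apply/seteqP; split=> _ [m' ->] /=.
  by exists (m' * m); rewrite gmulfM mulgA.
by exists (m' / m); rewrite multF mulgA mulgVK.
Qed.

(** A chosen preimage of a Schreier element; [liftE] shows that one always exists. *)
Let lift q f : M := xget 1 [set m | b m = tau q * f / tau (q * f)].

Lemma liftE q f : b (lift q f) = tau q * f / tau (q * f).
Proof.
apply: (@xgetPex _ 1 [set m | b m = tau q * f / tau (q * f)]).
have [m1 ->] := tau_coset q; have [m2 ->] := tau_coset (q * f).
by exists (m1 / m2); rewrite /= multF invgM !mulgA -(mulgA (b m1)) mulgK.
Qed.

Lemma liftM m q f : lift (b m * q) f = lift q f.
Proof. by rewrite /lift -(mulgA (b m)) !tauM. Qed.

(** An inverse letter gets the inverse of the value of the letter read from the other end, so that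
    free cancellation holds whatever preimages were chosen. *)
Let step q (l : X * bool) : M :=
  if l.2 then (lift (q * letter l) (letter (l.1, false)))^-1
  else lift q (letter l).

Let eval_at := fix eval_at w q : M :=
  if w is l :: w' then step q l * eval_at w' (q * letter l) else 1.

Lemma eval_at_cat u w q :
  eval_at (u ++ w) q = eval_at u q * eval_at w (q * pres_word _ u).
Proof.
elim: u q => [|l u IHu] q /=; first by rewrite mul1g mulg1.
by rewrite IHu mulgA -[l :: u]cat1s pres_word_cat mulgA.
Qed.

Lemma letterK x c : letter (x, c) * letter (x, ~~ c) = 1.
Proof. by rewrite -pres_word_cat; apply/pres_wordP/WordCancel. Qed.

Lemma eval_at_cong u w q : word_cong set0 u w -> eval_at u q = eval_at w q.
Proof.
move=> uw; elim: uw q => {u w} //.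
- by move=> u v w _ IH1 _ IH2 q; rewrite IH1.
- move=> u u' v v' /pres_wordP uu' IHu _ IHv q.
  by rewrite !eval_at_cat IHu IHv uu'.
- move=> x c q /=; rewrite mulg1 /step; case: c => /=; first by rewrite mulVg.
  by rewrite -(mulgA q) letterK mulg1 mulgV.
Qed.

Lemma eval_atE w q :
  b (eval_at w q) = tau q * pres_word _ w / tau (q * pres_word _ w).
Proof.
elim: w q => [|[x c] w IHw] q; first by rewrite /= mult1 !mulg1 mulgV.
rewrite -cat1s pres_word_cat /= gmulfM IHw -[pres_word _ [:: _]]/(letter (x, c)).
have -> : b (step q (x, c)) = tau q * letter (x, c) / tau (q * letter (x, c)).
  rewrite /step; case: c => /=; last exact: liftE.
  rewrite multV liftE -(mulgA q) letterK mulg1 !invgM invgK !mulgA.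
  congr (_ * _); congr (_ * _).
  apply: (mulgI (letter (x, false))); rewrite mulgV; exact/esym/letterK.
by rewrite !mulgA mulgVK.
Qed.

(** The base point matters only through its coset. With [eval_at_cat] this makes the cocycle
    multiplicative on the image of [b]. *)
Lemma eval_atM m w q : eval_at w (b m * q) = eval_at w q.
Proof.
elim: w q => //= l w IHw q; rewrite -(mulgA (b m)) IHw; congr (_ * _).
by rewrite /step -(mulgA (b m)) !liftM.
Qed.

(* A subgroup of a free group is projective: the cocycle [eval_at] is the action
   of the free group on the coset space induced from a transversal. *)
Lemma free_section : exists p : M -> M,
  [/\ {morph p : x y / x * y}, forall x, b (p x) = b x
    & forall x y, b x = b y -> p x = p y].
Proof.
(* At base point 1 the cocycle lifts [b x] only up to conjugation by [tau 1 = b m0]; conjugating by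
   [m0] corrects this. *)
have [m0 tau1] := tau_coset 1; rewrite mulg1 in tau1.
exists (fun x => eval_at (pres_repr (b x)) 1 ^ m0).
split=> [x y|x|x y ->//].
  rewrite -conjMg; congr (_ ^ _).
  rewrite (@eval_at_cong _ (pres_repr (b x) ++ pres_repr (b y))).
    by rewrite eval_at_cat pres_reprK mul1g -(eval_atM x (pres_repr (b y)) 1) mulg1.
  by apply/pres_wordP; rewrite pres_word_cat !pres_reprK gmulfM.
rewrite multJ eval_atE pres_reprK mul1g -[in X in _ / X](mulg1 (b x)) tauM tau1.
by rewrite conjgE mulgVK mulKg.
Qed.
End FreeSection.

(** * Tensor products of crossed modules *)

Section Abelianization.
Variable T : groupType.
Implicit Types (x y : T).

Definition ab_rel : set (word T * word T) :=
  [set r | exists x y, r = ([:: (x * y, false)], [:: (x, false); (y, false)])] `|`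
  [set r | exists x y,
     r = ([:: (x, false); (y, false)], [:: (y, false); (x, false)])].

Definition ab : groupType := presented ab_rel.
Definition to_ab x : ab := pres_gen ab_rel x.

Lemma to_abM : {morph to_ab : x y / x * y}.
Proof.
move=> x y; rewrite /to_ab /pres_gen -pres_word_cat; apply/pres_wordP/WordRel.
by left; exists x, y.
Qed.
HB.instance Definition _ := isMultiplicative.Build T ab to_ab to_abM.

Lemma to_ab_surj a : exists x, a = to_ab x.
Proof.
move: a; apply: pres_ind => [|_ _ [x ->] [y ->]|_ [x ->]|x].
- by exists 1; rewrite mult1.
- by exists (x * y); rewrite to_abM.
- by exists x^-1; rewrite multV.
- by exists x.
Qed.

Lemma abC (a b : ab) : a * b = b * a.
Proof.
have [x ->] := to_ab_surj a; have [y ->] := to_ab_surj b.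
rewrite /to_ab /pres_gen -!pres_word_cat; apply/pres_wordP/WordRel.
by right; exists x, y.
Qed.

Section Lift.
Variables (K : groupType) (f : T -> K).
Hypotheses (fM : {morph f : x y / x * y}) (fC : forall x y, f x * f y = f y * f x).

Lemma ab_lift_rel r : ab_rel r -> word_eval f r.1 = word_eval f r.2.
Proof.
case=> -[x [y ->]]; rewrite /word_eval !big_cons !big_nil /= !mulg1.
  exact: fM.
exact: fC.
Qed.

Definition ab_lift (a : ab) : K := pres_lift f a.

Lemma ab_liftM : {morph ab_lift : a b / a * b}.
Proof. exact: (pres_liftM ab_lift_rel). Qed.

Lemma ab_liftE x : ab_lift (to_ab x) = f x.
Proof. exact: (pres_lift_gen ab_lift_rel). Qed.
End Lift.

Section Action.
Variables (F : groupType) (act : raction F T).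

Let act_ab g x := to_ab (act x g).

Lemma act_abM g : {morph act_ab g : x y / x * y}.
Proof. by move=> x y; rewrite /act_ab ract_morph to_abM. Qed.
Let act_abC g x y : act_ab g x * act_ab g y = act_ab g y * act_ab g x.
Proof. exact: abC. Qed.

Definition ab_act_fun (a : ab) (g : F) : ab := ab_lift (act_ab g) a.

Lemma ab_act_funE x g : ab_act_fun (to_ab x) g = to_ab (act x g).
Proof. exact: (ab_liftE (@act_abM g) (@act_abC g)). Qed.

Lemma ab_act1 a : ab_act_fun a 1 = a.
Proof. by have [x ->] := to_ab_surj a; rewrite ab_act_funE ract1. Qed.

Lemma ab_actM a g h : ab_act_fun a (g * h) = ab_act_fun (ab_act_fun a g) h.
Proof. by have [x ->] := to_ab_surj a; rewrite !ab_act_funE ractM. Qed.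

Lemma ab_act_morph a b g : ab_act_fun (a * b) g = ab_act_fun a g * ab_act_fun b g.
Proof. exact: (ab_liftM (@act_abM g) (@act_abC g)). Qed.

Definition ab_act : raction F ab := RAction ab_act1 ab_actM ab_act_morph.

Lemma ab_actE x g : ab_act (to_ab x) g = to_ab (act x g).
Proof. exact: ab_act_funE. Qed.
End Action.
End Abelianization.

Definition xm_ker (G : groupType) (M : crossed_module G) : set (xm_car M) :=
  [set t | xm_bd M t = 1].
Arguments xm_ker {G} M _.

(** * The displacement map and generators of the tensor product *)

Section CrossedModule.
Variables (G : groupType) (M : crossed_module G).
Local Notation T := (xm_car M).
Local Notation act := (xm_act M).
Local Notation bd := (xm_bd M).
Local Notation elM := (@elt G M).
Implicit Types (t s : T) (g h : G) (x y : tens M).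

Lemma xm_ker_subgroup : is_subgroup (xm_ker M).
Proof. exact: kernel_subgroup. Qed.

Lemma xm_kerC t s : xm_ker M t -> t * s = s * t.
Proof. by move=> kt; rewrite (conjgC s) -xm_peiffer kt ract1. Qed.

Lemma elt1l g : elM 1 g = 1.
Proof.
apply: (mulIg (elM (1 : T) g)); rewrite mul1g -[in RHS](mulg1 (1 : T)) eltMl.
by rewrite conjg1 mult1 conjg1.
Qed.

Lemma elt1r t : elM t 1 = 1.
Proof.
apply: (mulIg (elM t (1 : G))); rewrite mul1g -[in RHS](mulg1 (1 : G)) eltMr.
by rewrite ract1 conjg1.
Qed.

Lemma diagE t g h : diag_act M (elM t g) h = elM (act t h) (g ^ h).
Proof. exact: diag_act_elt. Qed.

Definition displacement_gen (p : T * G) : T := p.1^-1 * act p.1 p.2.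

Lemma displacement_rel r : tensor_rel act (bd_act M : raction T G) r ->
  word_eval displacement_gen r.1 = word_eval displacement_gen r.2.
Proof.
apply: step_lift_rel => [t s g|t g h]; rewrite /displacement_gen /=.
  have -> : act (t ^ s) (g ^ bd s) = act t g ^ s.
    by rewrite -!xm_peiffer -!ractM -conjgC.
  by rewrite ract_morph -conjVg -conjMg conjgE invgM !mulgA mulgK.
by rewrite -[act (act _ _) _]ractM -conjgC mulgA mulgK.
Qed.

Definition displacement (x : tens M) : T := pres_lift displacement_gen x.

Lemma displacementM : {morph displacement : x y / x * y}.
Proof. exact: (pres_liftM displacement_rel). Qed.
HB.instance Definition _ :=
  isMultiplicative.Build (tens M) T displacement displacementM.

Lemma displacement_elt t g : displacement (elM t g) = t^-1 * act t g.
Proof. exact: (pres_lift_gen displacement_rel). Qed.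

(** Hence the displacement sends the kernel of the commutator map into that of [bd]. *)
Lemma bd_displacement x : bd (displacement x) = comm_map x.
Proof.
move: x; apply: tens_ext => [x y|x y|t g].
- by rewrite displacementM gmulfM.
- exact: comm_map_morph.
- by rewrite displacement_elt gmulfM multV xm_equiv comm_map_elt.
Qed.

Lemma elt_displacementM x y g :
  elM (displacement (x * y)) g = elM (displacement x) g ^ y * elM (displacement y) g.
Proof.
by rewrite displacementM eltMl -xm_peiffer -diagE bd_displacement step_peiffer.
Qed.

(** Both sides are crossed homomorphisms in [x], which leaves the generators [elM t h]. There
    [elM t (h * g)] is expanded in two ways, since [h * g] equals [g ^ h^-1 * h]. *)
Lemma elt_displacement x g : elM (displacement x) g = x^-1 * diag_act M x g.
Proof.
move: x; apply: pres_ind => [|x y IHx IHy|x IHx|[t h]].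
- by rewrite mult1 elt1l act_id mulg1 invg1.
- rewrite elt_displacementM IHx IHy ract_morph conjgE invgM !mulgA.
  by rewrite mulgK.
- apply: (mulgI (elM (displacement x) g ^ x^-1)).
  rewrite -elt_displacementM mulgV mult1 elt1l act_inv IHx conjgE !invgK !mulgA.
  by rewrite mulgV mul1g mulgVK mulgV.
rewrite -[pres_gen _ _]/(elM t h) displacement_elt diagE.
apply: (mulgI (elM t g ^ elM t h)).
have e1 : elM t (h * g) = elM t g * elM (act t g) (h ^ g) by exact: eltMr.
have e2 : elM t (h * g) = elM t h * elM (act t h) g.
  by rewrite (conjgCV h g) eltMr conjgKV.
have e3 : elM (act t h) g = elM t g ^ elM t h * elM (t^-1 * act t h) g.
  rewrite -[in LHS](mulVKg t (act t h)) eltMl -xm_peiffer -diagE.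
  by rewrite -[bd _]/(bd _) -displacement_elt bd_displacement step_peiffer.
rewrite -e3; apply: (mulgI (elM t h)); rewrite -e2 e1 conjgE !mulgA mulgV mul1g.
by rewrite mulgK.
Qed.

(** The tensor relations are additive up to the action, under which the span is stable. So
    generators suffice, first in the right argument, then in the left one. *)
Lemma tens_act_span (s : seq T) (X : seq G) :
    act_span act setT [set` s] = setT -> generated [set` X] = setT ->
  act_span (diag_act M) setT [set` [seq elM m g | m <- s, g <- X]] = setT.
Proof.
move=> genT genG; set S := act_span _ _ _.
have sS : is_subgroup S by apply: act_span_subgroup.
have iS x g : S x -> S (diag_act M x g) by exact: act_span_invariant.
have tS t : t \in s -> forall g, S (elM t g).
  move=> ts g; suff: generated [set` X] `<=` [set g | S (elM t g)].
    by apply; rewrite genG.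
  apply: generated_sub => [|h Xh]; last first.
    by apply: sub_act_span; apply/allpairsP; exists (t, h).
  have M2 a b : elM t (a * b) = elM t b * diag_act M (elM t a) b.
    by rewrite eltMr diagE.
  apply: subgroupP => [|a b|a] /=.
  - by rewrite elt1r; apply: subgroup1.
  - by move=> Sa Sb; rewrite M2; apply: (subgroupM sS) => //; apply: iS.
  - move=> Sa; have := M2 a a^-1; rewrite mulgV elt1r => M1.
    apply: (subgroupMr sS (iS _ a^-1 Sa)); rewrite -M1; exact: subgroup1.
have TS t : forall g, S (elM t g).
  suff: act_span act setT [set` s] `<=` [set t | forall g, S (elM t g)].
    by apply; rewrite genT.
  have M2 a b g : elM (a * b) g = diag_act M (elM a g) (bd b) * elM b g.
    by rewrite eltMl -xm_peiffer diagE.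
  apply: act_span_sub => //; last first.
    move=> a g _ Sa h; rewrite -[h](conjgKV g) -diagE; apply: iS; exact: Sa.
  apply: subgroupP => [g|a b Sa Sb g|a Sa g] /=.
  - by rewrite elt1l; apply: subgroup1.
  - by rewrite M2; apply: (subgroupM sS) => //; apply: iS.
  - have := M2 a a^-1 g; rewrite mulgV elt1l => M1.
    by apply: (subgroupMl sS (iS _ (bd a^-1) (Sa g))); rewrite -M1; apply: subgroup1.
apply/seteqP; split=> // x _; move: x; apply: (presented_subgroup sS) => -[t g].
exact: TS.
Qed.

Lemma range_comm_map : range (@comm_map G M) = comm_subgroup (range bd) setT.
Proof.
apply/seteqP; split=> [_ [x _ <-]|].
  have sC : is_subgroup (comm_subgroup (range bd) setT) := generated_subgroup _.
  move: x; apply: (presented_subgroup (premult_subgroup (@comm_map G M) sC)).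
  move=> [t g] /=; rewrite -[pres_gen _ _]/(elM t g) comm_map_elt.
  by apply: mem_comm; exists t.
apply: generated_sub => [|_ [_ [g [[t _ <-] _ ->]]]]; first exact: range_subgroup.
by exists (elM t g); rewrite ?comm_map_elt.
Qed.
End CrossedModule.

(** * The kernel for free groups *)

Section FreeCase.

Lemma fingen_extension (A B : groupType) (f : {multiplicative A -> B}) (S : set A) :
    is_subgroup S -> fingen (f @` S) -> fingen (S `&` [set x | f x = 1]) -> fingen S.
Proof.
move=> sS [s sE] [r rE].
have [l lS sEl] : exists2 l : seq A, [set` l] `<=` S & s = map f l.
  have : [set` s] `<=` f @` S by rewrite sE; apply: sub_generated.
  elim: s {sE} => [|y s IHs] sS'; first by exists [::].
  have [x xs|l lS ->] := IHs; first by apply: sS'; rewrite /= inE [x \in s]xs orbT.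
  have [x Sx <-] : (f @` S) y by apply: sS'; rewrite /= inE eqxx.
  by exists (x :: l) => // z; rewrite /= inE => /orP[/eqP->|/lS].
have sG := generated_subgroup [set` r ++ l].
have subG (t : seq A) : {subset t <= r ++ l} ->
    generated [set` t] `<=` generated [set` r ++ l].
  by move=> sub; apply: generatedS => x; apply: sub.
apply: (@fingenP _ _ (r ++ l)) => // [x /=|x Sx].
  rewrite mem_cat => /orP[xr|/lS //]; suff [] : (S `&` [set x | f x = 1]) x by [].
  by rewrite rE; apply: sub_generated.
have : generated [set` s] (f x) by rewrite -sE; exists x.
have imS := image_subgroup f (generated_subgroup [set` l]).
rewrite sEl => /(generated_sub imS)[|y ly yE].
  by move=> _ /= /mapP[y ly ->]; exists y => //; apply: sub_generated.
have Sy : S y by apply: (generated_sub sS lS).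
rewrite -[x](mulgVK y); apply: (subgroupM sG); last first.
  by apply: subG ly => z; rewrite mem_cat orbC => ->.
apply: (@subG r) => [z|]; first by rewrite mem_cat => ->.
by rewrite -rE; split; [apply: sS.2 | rewrite /= multF yE mulgV].
Qed.

Variable X : choiceType.
Let F := free X.

Lemma tensor_ker_fingen (M : crossed_module F) (gF : seq F) (gM : seq (xm_car M)) :
    generated [set` gF] = setT -> act_span (xm_act M) setT [set` gM] = setT ->
    polycyclic_over (range (@comm_map F M)) setT -> fingen (xm_ker M) ->
  fingen (xm_ker (tensor_step M)).
Proof.
move=> genF genM polyF kerM.
pose T := tens M; pose b : {multiplicative T -> F} := xm_bd (tensor_step M).
pose act : raction F T := xm_act (tensor_step M).
set K := xm_ker (tensor_step M).
have sK : is_subgroup K by exact: xm_ker_subgroup.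
have KC x y : K x -> x * y = y * x by exact: xm_kerC.
pose f : {multiplicative T -> xm_car M} := @displacement F M.
(* The image of [K] under the displacement lies in the abelian, finitely generated kernel of [M]. *)
apply: (fingen_extension (f := f)) => //.
  apply: (fingen_sub_abelian kerM) => [x y kx _||_ [x Kx <-]].
  - exact: xm_kerC.
  - exact: image_subgroup.
  - by rewrite /xm_ker /= bd_displacement.
set K0 := K `&` _.
have sK0 : is_subgroup K0 by apply: subgroupI => //; apply: (kernel_subgroup f).
have fixK0 x g : K0 x -> act x g = x.
  move=> [_ /= fx]; have := elt_displacement x g.
  by rewrite -/(f x) fx elt1l => /(congr1 (mul x)); rewrite mulVKg mulg1.
(* As [p] factors through [b], the map [x / p x] is a retraction of [T] onto the central subgroup
   [K]. It factors through the abelianization, so [K] embeds there. *)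
have [p [pM bp pE]] := free_section b.
have Kq x : K (x / p x) by rewrite /K /xm_ker /= multF bp mulgV.
have qM : {morph (fun x => x / p x) : x y / x * y}.
  move=> x y; have -> : x * y / p (x * y) = x * (y / p y * (p x)^-1).
    by rewrite pM invgM !mulgA.
  by rewrite (KC (y / p y)) // mulgA.
pose q := ab_lift (fun x => x / p x).
have qE x : q (to_ab x) = x / p x by apply: ab_liftE => // y z; apply: KC.
have to_ab_injK x : K x -> to_ab x = 1 -> x = 1.
  move=> Kx x1; have := qE x; rewrite x1.
  have -> : q 1 = 1 by apply: morph1; apply: ab_liftM => // y z; apply: KC.
  have p1 : p 1 = 1 by apply: morph1.
  have -> : p x = p 1 by apply: pE; rewrite mult1.
  by rewrite p1 invg1 mulg1.
apply: (fingen_extension (f := @to_ab T)) => //; last first.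
  exists [::]; apply/seteqP; split=> x.
    by move=> [[Kx _] /(to_ab_injK _ Kx) ->]; apply: (subgroup1 (generated_subgroup _)).
  suff -> : generated [set` [::]] = [set 1 : T].
    by move=> ->; split; [apply: subgroup1 | rewrite /= mult1].
  apply/seteqP; split; last by move=> _ ->; apply: subgroup1 (generated_subgroup _).
  by apply: generated_sub => //; apply: trivial_subgroup.
set S := _ @` K0.
have sS : is_subgroup S by apply: (image_subgroup (@to_ab T)).
pose aact := ab_act act.
have fixS a g : S a -> aact a g = a by move=> [x Kx <-]; rewrite ab_actE fixK0.
(* By the Peiffer identity the range of the commutator map acts on [T] by inner automorphisms, hence
   trivially on the abelianization. *)
have noeV : noetherian aact setT (act_span aact setT
    [set` [seq to_ab x | x <- [seq elt m g | m <- gM, g <- gF]]]).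
  apply: noetherian_polycyclic polyF; first exact: abC.
    exact: range_subgroup.
  move=> a _ [y _ <-]; have [x ->] := to_ab_surj a.
  rewrite ab_actE [act x _](step_peiffer x y).
  rewrite (multJ (@to_ab T)) conjgE (abC (to_ab x)) mulKg //.
have [|a Sa|s [sSs Ss]] := noeV S sS.
- by move=> a g _ Sa; rewrite fixS.
- have [x ->] := to_ab_surj a.
  have : act_span act setT [set` [seq elt m g | m <- gM, g <- gF]] x.
    by rewrite [act_span _ _ _]tens_act_span.
  set A := act_span aact _ _; have sA : is_subgroup A by apply: act_span_subgroup.
  apply: (act_span_sub (premult_subgroup (@to_ab T) sA)) => [y g _ Ay|y ys].
    by change (A (to_ab (act y g))); rewrite -ab_actE; apply: act_span_invariant.
  by apply: sub_act_span; apply: map_f.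
(* The action on [S] is trivial, so module generators are group generators. *)
apply: (fingenP sS sSs) => a /Ss; apply: act_span_sub => //; last exact: sub_generated.
  exact: generated_subgroup.
move=> c g _ gc; rewrite fixS //; exact: (generated_sub sS sSs).
Qed.
End FreeCase.

Lemma range_nfold (G : groupType) n :
  range (xm_bd (nfold_xm G n.+1)) = lower_series setT n.
Proof.
elim: n => [|n IHn]; first by apply/seteqP; split=> // x _; exists x.
rewrite nfold_xmS [LHS]range_comm_map IHn //.
Qed.

Lemma free_generated r : generated [set` codom (pres_gen (X := 'I_r) set0)] = setT.
Proof.
apply/seteqP; split=> // x _; move: x.
apply: presented_subgroup (generated_subgroup _) _ => i.
by apply: sub_generated; apply: codom_f.
Qed.

(** The induction must also carry finitely many module generators of the tensor power. *)
Lemma free_nfold_ker_fingen r n : fingen (xm_ker (nfold_xm (free 'I_r) n.+1)).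
Proof.
pose F := free 'I_r; pose gF : seq F := codom (pres_gen (X := 'I_r) set0).
have genF : generated [set` gF] = setT := free_generated r.
have polyF k : polycyclic_over (lower_series [set: F] k) setT.
  apply: (polycyclic_lower_series _ (s := gF) genF) => //.
  apply/seteqP; split=> //; rewrite -[X in X `<=` _]genF.
  by apply: generatedS; apply: subsetUr.
suff [] : fingen (xm_ker (nfold_xm F n.+1)) /\ exists gM : seq (xm_car (nfold_xm F n.+1)),
    act_span (xm_act (nfold_xm F n.+1)) setT [set` gM] = setT by [].
elim: n => [|n [kerM [gM genM]]].
  split.
    exists [::]; apply/seteqP; split=> [x kx|x].
      by have -> : x = 1 by []; apply: (subgroup1 (generated_subgroup _)).
    by apply: (generated_sub (trivial_subgroup F)).
  exists gF; apply/seteqP; split=> //; rewrite -[X in X `<=` _]genF.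
  apply: generated_sub; [exact: act_span_subgroup | exact: sub_act_span].
rewrite nfold_xmS; split; last first.
  by exists [seq elt m g | m <- gM, g <- gF]; apply: tens_act_span.
apply: (tensor_ker_fingen genF genM) => //.
by rewrite -[range _]/(range (xm_bd (nfold_xm F n.+2))) range_nfold.
Qed.

(** * Reduction to free groups *)

Section CrossedMap.
Variables (F G : groupType) (phi : {multiplicative F -> G}).
Variables (M : crossed_module F) (N : crossed_module G).

(** A morphism of crossed modules over [phi]. *)
Record crossed_map (f : xm_car M -> xm_car N) : Prop := CrossedMapAxioms {
  crossed_mapM : {morph f : x y / x * y};
  crossed_map_bd : forall x, xm_bd N (f x) = phi (xm_bd M x);
  crossed_map_act : forall x g, f (xm_act M x g) = xm_act N (f x) (phi g)
}.

Variables (f : xm_car M -> xm_car N) (fP : crossed_map f).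

Definition tens_map_gen (p : xm_car M * F) : tens N := elt (f p.1) (phi p.2).

Lemma tens_map_rel r : tensor_rel (xm_act M) (bd_act M) r ->
  word_eval tens_map_gen r.1 = word_eval tens_map_gen r.2.
Proof.
apply: step_lift_rel => [t s g|t g h]; rewrite /tens_map_gen /=.
  rewrite (crossed_mapM fP) eltMl (crossed_map_bd fP) -multJ.
  congr (elt _ _ * _); rewrite -!xm_peiffer (crossed_map_act fP) (crossed_map_bd fP) //.
by rewrite gmulfM eltMr -(crossed_map_act fP) multJ.
Qed.

Definition tens_map (x : tens M) : tens N := pres_lift tens_map_gen x.

Lemma tens_mapE t g : tens_map (elt t g) = elt (f t) (phi g).
Proof. exact: (pres_lift_gen tens_map_rel). Qed.

Lemma tens_mapM : {morph tens_map : x y / x * y}.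
Proof. exact: (pres_liftM tens_map_rel). Qed.
End CrossedMap.

Lemma tens_map_crossed (F G : groupType) (phi : {multiplicative F -> G})
    (M : crossed_module F) (N : crossed_module G) (f : xm_car M -> xm_car N) :
  crossed_map phi f ->
  @crossed_map F G phi (tensor_step M) (tensor_step N) (tens_map phi f).
Proof.
move=> fP; have TM := tens_mapM fP; split=> // [x|x g] /=; move: x; apply: tens_ext.
- by move=> x y; rewrite TM comm_map_morph.
- by move=> x y; rewrite comm_map_morph gmulfM.
- by move=> t g; rewrite tens_mapE // !comm_map_elt (crossed_map_bd fP) multR.
- by move=> x y; rewrite diag_act_morph TM.
- by move=> x y; rewrite TM diag_act_morph.
- by move=> t h; rewrite !(diag_act_elt, tens_mapE) // (crossed_map_act fP) multJ.
Qed.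

Section Reduction.
Variables (F G : groupType) (phi : {multiplicative F -> G}).
Hypothesis phi_surj : forall g, exists x, phi x = g.
Let R : set F := [set x | phi x = 1].

(** For the last clause: if [y] lifts [z] and [f y = 1], then [elt y g] lifts [[~ z, g]] and is
    mapped to [elt 1 (phi g) = 1]. *)
Lemma nfold_map n :
  exists f : xm_car (nfold_xm F n.+1) -> xm_car (nfold_xm G n.+1),
  [/\ crossed_map phi f, forall y, exists x, f x = y
    & forall x, lower_series R n x ->
        exists2 y, xm_bd (nfold_xm F n.+1) y = x & f y = 1].
Proof.
elim: n => [|n [f [fP fsurj fR]]].
  exists phi; split=> //; first by split=> //; [exact: gmulfM | exact: multJ].
  by move=> x Rx; exists x.
rewrite !nfold_xmS; exists (tens_map phi f); have TM := tens_mapM fP.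
pose h : {multiplicative tens (nfold_xm F n.+1) -> tens (nfold_xm G n.+1)} :=
  HB.pack (tens_map phi f) (isMultiplicative.Build _ _ _ TM).
split; first exact: tens_map_crossed.
  apply: pres_ind => [|_ _ [x <-] [y <-]|_ [x <-]|[t g]].
  - by exists 1; apply: (mult1 h).
  - by exists (x * y); apply: TM.
  - by exists x^-1; apply: (multV h).
  - have [x <-] := fsurj t; have [a <-] := phi_surj g.
    by exists (elt x a); rewrite tens_mapE.
move=> x; pose A := [set x | exists2 y, comm_map (M := nfold_xm F n.+1) y = x & h y = 1].
suff : comm_subgroup (lower_series R n) setT `<=` A by apply.
apply: generated_sub => [|_ [z [g [Rz _ ->]]]].
  split=> [|_ _ [y <- hy] [z <- hz]]; first by exists 1; rewrite ?mult1.
  by exists (y / z); rewrite ?multF // hy hz mulgV.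
have [y yE fy] := fR z Rz; exists (elt y g); first by rewrite comm_map_elt yE.
by rewrite [h _]tens_mapE // fy elt1l.
Qed.

Lemma nfold_ker_fingen n (gF s : seq F) :
    generated [set` gF] = setT -> R = generated (comm_subgroup R setT `|` [set` s]) ->
    fingen (xm_ker (nfold_xm F n.+1)) ->
  fingen (xm_ker (nfold_xm G n.+1)).
Proof.
move=> genF RE [kF kFE].
have sR : is_subgroup R := kernel_subgroup phi.
have nR : normal_set R by move=> x y; rewrite /R /= multJ => ->; apply: conj1g.
have polyR := polycyclic_lower_series n genF sR nR RE.
have [f [fP fsurj fR]] := nfold_map n.
pose h : {multiplicative xm_car (nfold_xm F n.+1) -> xm_car (nfold_xm G n.+1)} :=
  HB.pack f (isMultiplicative.Build _ _ _ (crossed_mapM fP)).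
have hbd x : xm_bd (nfold_xm G n.+1) (h x) = phi (xm_bd (nfold_xm F n.+1) x).
  exact: (crossed_map_bd fP).
set bF := xm_bd (nfold_xm F n.+1).
have sbF : is_subgroup (range bF) := range_subgroup bF.
have sRn := lower_series_subgroup n sR.
have [||z [//]|t [tS St]] := polycyclic_over_fingen sRn polyR (S := R `&` range bF).
- exact: subgroupI.
- move=> x Rx; split; first exact: (polycyclic_sub polyR).
  by have [y <- _] := fR x Rx; exists y.
have [c cP] : exists c : F -> xm_car (nfold_xm F n.+1),
    forall z, range bF z -> bF (c z) = z.
  suff /choice[c cP] z : exists y, range bF z -> bF y = z by exists c.
  by have [[y _ yE]|nz] := pselect (range bF z); [exists y | exists 1].
pose l := map h kF ++ map (h \o c) t.
have sL := generated_subgroup [set` l].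
have kL y : xm_ker (nfold_xm F n.+1) y -> generated [set` l] (h y).
  rewrite kFE; apply: (generated_sub (premult_subgroup h sL)) => x kx.
  by apply: sub_generated; rewrite /= mem_cat map_f.
apply: (@fingenP _ _ l); first exact: xm_ker_subgroup.
  move=> y /=; rewrite mem_cat => /orP[] /mapP[x xl ->{y}]; rewrite /xm_ker /= hbd.
    suff -> : bF x = 1 by rewrite mult1.
    by rewrite -[_ = _]/(xm_ker (nfold_xm F n.+1) x) kFE; apply: sub_generated.
  by have [Rx bx] := tS _ xl; rewrite -/bF cP.
(* [U] contains [lower_series R n], whose elements have lifts that [h] kills, and [t], by the choice
   of [l]; so it contains all of [R] in the range of [bF]. *)
pose U : set F := [set x | exists2 y, bF y = x & generated [set` l] (h y)].
have sU : is_subgroup U.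
  split=> [|_ _ [y <- hy] [z <- hz]].
    by exists 1; rewrite mult1 //; apply: subgroup1.
  by exists (y / z); rewrite multF //; apply: sL.2.
have SU : R `&` range bF `<=` U.
  move=> x /St; apply: (generated_sub sU) => {}x [/fR[y yE fy]|xt].
    by exists y => //; rewrite [h y]fy; apply: subgroup1.
  exists (c x); first by have [_ ?] := tS _ xt; rewrite cP.
  by apply: sub_generated; rewrite /= mem_cat (map_f (h \o c)) ?orbT.
move=> x kx; have [y yx] := fsurj x; rewrite -{}yx in kx *.
(* [y] and [z] have the same boundary, so [y / z] lies in the kernel for [F], which [kL] covers. *)
have [|z zy hz] := SU (bF y).
  by split; [rewrite /R /= -hbd | exists y].
rewrite -[f y]/(h y) -[y](mulgVK z) gmulfM; apply: (subgroupM sL) => //.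
by apply: kL; rewrite /xm_ker /= multF -/bF zy mulgV.
Qed.
End Reduction.

(** * Finite presentability *)

Section FinitePresentation.

Lemma word_eval_mult (X : choiceType) (K L : groupType) (f : {multiplicative K -> L})
  (g : X -> K) w : f (word_eval g w) = word_eval (f \o g) w.
Proof.
elim: w => [|[x b] w IHw]; rewrite /word_eval ?big_nil ?big_cons ?mult1 //=.
by rewrite gmulfM; congr (_ * _); [case: b; rewrite ?multV | exact: IHw].
Qed.

Lemma word_eval_inv (X : choiceType) (K : groupType) (g : X -> K) w :
  word_eval g (word_inv w) = (word_eval g w)^-1.
Proof.
apply: (mulIg (word_eval g w)); rewrite mulVg -word_eval_cat.
rewrite (@word_eval_cong _ set0 _ g _ _ [::]) ?/word_eval ?big_nil //.
exact: word_invl.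
Qed.

Lemma generated_word (K : groupType) (s : seq K) x :
  generated [set` s] x -> exists w, word_eval (tnth (in_tuple s)) w = x.
Proof.
pose A := [set x | exists w, word_eval (tnth (in_tuple s)) w = x].
suff : generated [set` s] `<=` A by apply.
apply: generated_sub => [|y ys].
  split=> [|_ _ [u <-] [v <-]]; first by exists [::]; rewrite /word_eval big_nil.
  by exists (u ++ word_inv v); rewrite word_eval_cat word_eval_inv.
have /tnthP[i ->] : y \in in_tuple s by [].
by exists [:: (i, false)]; rewrite /word_eval big_cons big_nil mulg1.
Qed.

(** A presentation given by generators inside [G] instead of an isomorphism, which is easier to
    transport along homomorphisms. *)
Definition presents (X : choiceType) (R : set (word X * word X)) (G : groupType)
    (g : X -> G) : Prop :=
  [/\ forall r, R r -> word_eval g r.1 = word_eval g r.2,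
      forall x, exists w, word_eval g w = x
    & forall u v, word_eval g u = word_eval g v -> word_cong R u v].

Lemma presents_gen (X : choiceType) (R : set (word X * word X)) :
  presents R (pres_gen R).
Proof.
split=> [[u v] Ruv|x|u v].
- by rewrite -!pres_word_eval; apply/pres_wordP/WordRel.
- by exists (pres_repr x); rewrite -pres_word_eval pres_reprK.
- by rewrite -!pres_word_eval => /pres_wordP.
Qed.

Lemma finitely_presentedP (G : groupType) : finitely_presented G <->
  exists n (R : seq (word 'I_n * word 'I_n)) (g : 'I_n -> G), presents [set` R] g.
Proof.
split=> [[n [R [f [f' fK f'K]]]]|[n [R [g [gR gsurj ginj]]]]]; exists n, R.
  exists (f \o pres_gen _); have [gR gs gi] := presents_gen [set` R].
  split=> [r Rr|x|u v].
  - by rewrite -!word_eval_mult gR.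
  - by have [w wE] := gs (f' x); exists w; rewrite -word_eval_mult wE f'K.
  - by rewrite -!word_eval_mult => /(can_inj fK)/gi.
pose f : presented [set` R] -> G := pres_lift g.
have fM : {morph f : x y / x * y} by exact: pres_liftM.
pose h : {multiplicative presented [set` R] -> G} :=
  HB.pack f (isMultiplicative.Build _ _ _ fM).
exists h; have fsurj x : exists p, f p = x.
  by have [w wE] := gsurj x; exists (pres_word _ w); rewrite /f pres_lift_word.
have finj : injective f.
  move=> p q; rewrite -[p]pres_reprK -[q]pres_reprK /f !pres_lift_word //.
  by move=> /ginj/pres_wordP.
by have [f' f'K] := choice fsurj; exists f' => // p; apply: finj; apply: f'K.
Qed.

Lemma word_cong_map (X Y : choiceType) (R : set (word X * word X))
    (S : set (word Y * word Y)) (e : X -> Y) :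
    let m := map (fun l : X * bool => (e l.1, l.2)) in
    (forall u v, R (u, v) -> word_cong S (m u) (m v)) ->
  forall u v, word_cong R u v -> word_cong S (m u) (m v).
Proof.
move=> m RS u v; elim=> {u v}.
- by move=> u; apply: WordRefl.
- by move=> u v _; apply: WordSym.
- by move=> u v w _ uv _; apply: WordTrans.
- by move=> u u' v v' _ uu' _ vv'; rewrite /m !map_cat; apply: WordCat.
- by move=> x b; apply: WordCancel.
- exact: RS.
Qed.

Lemma presents_fin (X : finType) (R : seq (word X * word X)) (G : groupType)
  (g : X -> G) : presents [set` R] g -> finitely_presented G.
Proof.
move=> [gR gsurj ginj]; apply/finitely_presentedP.
pose m (w : word X) : word 'I_#|X| := map (fun l : X * bool => (enum_rank l.1, l.2)) w.
pose m' (w : word 'I_#|X|) : word X :=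
  map (fun l : 'I_#|X| * bool => (enum_val l.1, l.2)) w.
have m'K : cancel m' m.
  by move=> w; rewrite /m /m' -map_comp map_id_in // => -[i b] _ /=; rewrite enum_valK.
have evalm' w : word_eval g (m' w) = word_eval (g \o enum_val) w.
  by rewrite /word_eval /m' big_map.
have evalm w : word_eval (g \o enum_val) (m w) = word_eval g w.
  rewrite /word_eval /m big_map; apply: eq_bigr => -[x b] _ /=.
  by rewrite enum_rankK.
exists #|X|, [seq (m r.1, m r.2) | r <- R], (g \o enum_val).
split=> [_ /= /mapP[r Rr ->]|x|u v].
- by rewrite /= !evalm gR.
- by have [w <-] := gsurj x; exists (m w).
- rewrite -!evalm' => /ginj; rewrite -[u in X in _ -> X]m'K -[v in X in _ -> X]m'K.
  apply: word_cong_map => u' v' Ruv; apply: WordRel; apply/mapP.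
  by exists (u', v').
Qed.

(** A word for each generator of the kernel becomes an additional relator. *)
Lemma finitely_presented_quotient (G H : groupType) (f : {multiplicative G -> H}) :
    finitely_presented G -> (forall y, exists x, f x = y) ->
    fingen [set x | f x = 1] ->
  finitely_presented H.
Proof.
move=> /finitely_presentedP[n [R [g [gR gsurj ginj]]]] fsurj [s kerE].
apply/finitely_presentedP; have [c cE] := choice gsurj.
pose R' := R ++ [seq (c x, [::]) | x <- s].
have RR' u v : word_cong [set` R] u v -> word_cong [set` R'] u v.
  elim=> {u v}.
  - by move=> u; apply: WordRefl.
  - by move=> u v _; apply: WordSym.
  - by move=> u v w _ uv _; apply: WordTrans.
  - by move=> u u' v v' _ uu' _; apply: WordCat.
  - by move=> x b; apply: WordCancel.
  - by move=> u v Ruv; apply: WordRel; rewrite /= mem_cat [_ \in R]Ruv.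
have fs x : x \in s -> f x = 1.
  by move=> xs; rewrite -[_ = _]/([set x | f x = 1] x) kerE; apply: sub_generated.
exists n, R', (f \o g); split=> [r /=|y|u v].
- rewrite mem_cat => /orP[/gR gr|/mapP[x xs ->]].
    by rewrite -!word_eval_mult gr.
  by rewrite -!word_eval_mult /= cE fs // /word_eval big_nil mult1.
- by have [x <-] := fsurj y; exists (c x); rewrite -word_eval_mult cE.
have kercong w : f (word_eval g w) = 1 -> word_cong [set` R'] w [::].
  (* Quantifying over every word for [x] removes the dependence on the representative. *)
  pose A := [set x | forall w, word_eval g w = x -> word_cong [set` R'] w [::]].
  suff kerA : [set x | f x = 1] `<=` A by move=> /kerA; apply.
  rewrite kerE; apply: generated_sub => [|x xs w' wx].
    split=> [w' wE|x y Ax Ay w' wE].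
      by apply: RR'; apply: ginj; rewrite wE /word_eval big_nil.
    have [a aE] := gsurj x; have [c' c'E] := gsurj y.
    apply: (@WordTrans _ _ _ (a ++ word_inv c')).
      by apply: RR'; apply: ginj; rewrite wE word_eval_cat word_eval_inv aE c'E.
    rewrite -[X in word_cong _ _ X](cats0 [::]); apply: WordCat; first exact: Ax.
    exact: (word_inv_cong (Ay _ c'E)).
  apply: (@WordTrans _ _ _ (c x)); first by apply: RR'; apply: ginj; rewrite wx cE.
  by apply: WordRel; rewrite /= mem_cat (map_f (fun x => (c x, _))) ?orbT.
rewrite -!word_eval_mult => fuv.
have /kercong uv : f (word_eval g (u ++ word_inv v)) = 1.
  by rewrite word_eval_cat word_eval_inv multF fuv mulgV.
apply: (@WordTrans _ _ _ ((u ++ word_inv v) ++ v)).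
  rewrite -catA -[X in word_cong _ X]cats0; apply: WordCat; first exact: WordRefl.
  by apply: WordSym; apply: word_invl.
by rewrite -[X in word_cong _ _ X](cat0s v); apply: WordCat => //; apply: WordRefl.
Qed.

(** Take a group [P] on lifts of the generators of [H] and on central letters for the kernel, each
    relation of [H] being corrected by a central word. [P] maps onto [T], and the kernel lies in the
    finitely generated abelian subgroup [C] of central letters, so [finitely_presented_quotient]
    applies. *)
Lemma finitely_presented_central_extension (T H : groupType)
    (b : {multiplicative T -> H}) :
    finitely_presented H -> (forall y, exists x, b x = y) ->
    fingen [set x | b x = 1] -> (forall x y, b x = 1 -> x * y = y * x) ->
  finitely_presented T.
Proof.
move=> /finitely_presentedP[n [R [g [gR gsurj ginj]]]] bsurj [s kerE] kerC.
have [c cE] := choice bsurj; pose m := size s.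
pose k : 'I_m -> T := tnth (in_tuple s); pose y := c \o g.
have bk j : b (k j) = 1.
  rewrite -[_ = _]/([set x | b x = 1] (k j)) kerE; apply: sub_generated.
  by rewrite /=; apply: (mem_tnth j (in_tuple s)).
have by_ w : b (word_eval y w) = word_eval g w.
  by rewrite word_eval_mult; congr word_eval; apply: funext => i; rewrite /= cE.
pose X : finType := ('I_n + 'I_m)%type.
pose inL (w : word 'I_n) : word X := map (fun l : 'I_n * bool => (inl l.1, l.2)) w.
pose inR (w : word 'I_m) : word X := map (fun l : 'I_m * bool => (inr l.1, l.2)) w.
have [z zE] : exists z : word 'I_n * word 'I_n -> word 'I_m, forall r, r \in R ->
    word_eval k (z r) = word_eval y r.1 / word_eval y r.2.
  suff /choice[z zE] r : exists w, r \in R ->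
      word_eval k w = word_eval y r.1 / word_eval y r.2 by exists z.
  have [rR|nrR] := boolP (r \in R); last by exists [::].
  have [w wE] : exists w, word_eval k w = word_eval y r.1 / word_eval y r.2.
    by apply: generated_word; rewrite -kerE /= multF !by_ gR ?mulgV.
  by exists w.
pose S : seq (word X * word X) := [seq (inL r.1, inR (z r) ++ inL r.2) | r <- R] ++
  [seq ([:: (inr j, false); (x, false)], [:: (x, false); (inr j, false)])
     | j <- enum 'I_m, x <- enum X].
pose P : groupType := presented [set` S]; pose gen : X -> P := pres_gen [set` S].
pose yk (x : X) : T := match x with inl i => y i | inr j => k j end.
have evalL w : word_eval yk (inL w) = word_eval y w by rewrite /word_eval big_map.
have evalR w : word_eval yk (inR w) = word_eval k w by rewrite /word_eval big_map.
have ykS r : [set` S] r -> word_eval yk r.1 = word_eval yk r.2.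
  rewrite /= mem_cat => /orP[/mapP[q qR ->]|/allpairsP[[j x] [_ _ ->]]] /=.
    by rewrite word_eval_cat !evalL evalR zE // mulgVK.
  by rewrite /word_eval !big_cons !big_nil /= !mulg1 kerC.
pose f : P -> T := pres_lift yk; have fM : {morph f : x y / x * y} := pres_liftM ykS.
pose h : {multiplicative P -> T} := HB.pack f (isMultiplicative.Build _ _ _ fM).
have hgen x : h (gen x) = yk x by exact: (pres_lift_gen ykS).
pose C := generated [set` [seq gen (inr j) | j <- enum 'I_m]].
have sC : is_subgroup C := generated_subgroup _.
have Cgen j : C (gen (inr j)) by apply: sub_generated; apply: map_f; rewrite mem_enum.
have CC x p : C x -> x * p = p * x.
  have centr (T' : groupType) (q : T') : is_subgroup [set x | commute q x].
    apply: subgroupP => [|x' y'|x'] /=; [exact: commute1|exact: commuteM|exact: commuteV].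
  have gC : forall j, commute (gen (inr j)) p.
    move=> j; suff {p} : [set: P] `<=` [set p | commute (gen (inr j)) p] by apply.
    move=> p _; move: p; apply: (presented_subgroup (centr P (gen (inr j)))) => x'.
      have relS : [set` S] ([:: (inr j, false); (x', false)],
          [:: (x', false); (inr j, false)]).
        rewrite /= mem_cat; apply/orP; right.
        by apply/allpairsP; exists (j, x'); rewrite !mem_enum.
      have := WordRel relS; move/pres_wordP.
      by rewrite -cat1s -[X in _ = pres_word _ X]cat1s !pres_word_cat.
  move=> Cx; apply: commute_sym; move: x Cx; apply: (generated_sub (centr P p)).
  by move=> _ /= /mapP[j _ ->]; apply: commute_sym; apply: gC.
have fC x y' : C x -> C y' -> C (x * y') by exact: (subgroupM sC).
have inR_C w : C (pres_word _ (inR w)).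
  elim: w => [|[j e] w IHw]; first exact: (subgroup1 sC).
  rewrite /inR map_cons -cat1s pres_word_cat; apply: fC => //=.
  case: e; last exact: Cgen.
  rewrite -[[:: _]]/(word_inv [:: (inr j, false)]) pres_word_inv.
  exact: (subgroupV sC (Cgen j)).
pose cl w : P := pres_word _ (inL w).
have clM u v : cl (u ++ v) = cl u * cl v by rewrite /cl /inL map_cat pres_word_cat.
(* The relations of [H] hold in [P] modulo [C]. *)
have clC u v : word_cong [set` R] u v -> C (cl u / cl v).
  elim=> {u v}.
  - by move=> u; rewrite mulgV; apply: (subgroup1 sC).
  - by move=> u v _ uv; rewrite -invgF; apply: (subgroupV sC).
  - by move=> u v w _ uv _ vw; rewrite -(divgKA (cl v)); apply: fC.
  - move=> u u' v v' _ uu' _ vv'.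
    have -> : cl (u ++ v) / cl (u' ++ v') = cl u * (cl v / cl v') / cl u'.
      by rewrite !clM invgM !mulgA.
    by rewrite -(mulgA (cl u)) (CC _ _ vv') mulgA; apply: fC.
  - move=> x e; have -> : cl [:: (x, e); (x, ~~ e)] = cl [::].
      by apply/pres_wordP; apply: WordCancel.
    by rewrite mulgV; apply: (subgroup1 sC).
  - move=> u v Ruv; have -> : cl u = pres_word _ (inR (z (u, v))) * cl v.
      rewrite -pres_word_cat; apply/pres_wordP/WordRel; rewrite /= mem_cat.
      by apply/orP; left; apply/mapP; exists (u, v).
    by rewrite mulgK.
have split_word (w : word X) : exists u, C (pres_word _ w / cl u).
  elim: w => [|[x e] w [u Cu]].
    by exists [::]; rewrite mulgV; apply: (subgroup1 sC).
  case: x => [i|j].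
    exists ((i, e) :: u); rewrite -cat1s -[_ :: u]cat1s pres_word_cat clM invgM.
    rewrite -[pres_word _ [:: _]]/(cl [:: (i, e)]) !mulgA -(mulgA (cl [:: (i, e)])).
    by rewrite -(CC _ (cl [:: (i, e)]) Cu) mulgK.
  exists u; rewrite -cat1s pres_word_cat -mulgA; apply: fC => //.
  exact: (inR_C [:: (j, e)]).
have hword w : h (pres_word _ w) = word_eval yk w by exact: (pres_lift_word ykS).
have hC p : C p -> b (h p) = 1.
  move: p; apply: (generated_sub (premult_subgroup h (kernel_subgroup b))).
  move=> _ /= /mapP[j _ ->]; change (b (h (gen (inr j))) = 1); rewrite hgen.
  exact: bk.
(* Modulo [C], [p] is a word in the lifted generators. That word is trivial in [H], hence lies in
   [C] by [clC]. *)
have kerC' p : b (h p) = 1 -> C p.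
  move=> hp; have [u Cu] := split_word (pres_repr p); rewrite pres_reprK in Cu.
  have u1 : word_eval g u = word_eval g [::].
    have := hC _ Cu; rewrite multF multF hp hword evalL by_ mul1g => /(congr1 inv).
    by rewrite invgK invg1 => ->; rewrite /word_eval big_nil.
  have := clC _ _ (ginj _ _ u1); have -> : cl [::] = 1 by [].
  by rewrite invg1 mulg1 -[p](mulgVK (cl u)); apply: fC.
apply: (finitely_presented_quotient (f := h)).
- exact: presents_fin (presents_gen _).
- move=> x; have [w wE] := gsurj (b x).
  have [v vE] : exists v, word_eval k v = x / word_eval y w.
    by apply: generated_word; rewrite -kerE /= multF by_ wE mulgV.
  exists (pres_word _ (inR v ++ inL w)).
  by rewrite hword word_eval_cat evalR evalL vE mulgVK.
- apply: (@fingen_sub_abelian _ C); first by eexists.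
  + by move=> p q Cp _; apply: CC.
  + exact: kernel_subgroup.
  + by move=> p hp; apply: kerC'; rewrite hp mult1.
Qed.
End FinitePresentation.

(** * Finitely presented groups and the equivalence *)

Lemma presentation_kernel (n : nat) (R : seq (word 'I_n * word 'I_n)) (G : groupType)
    (phi : {multiplicative free 'I_n -> G}) :
    presents [set` R] (phi \o pres_gen set0) ->
  [set x | phi x = 1] = generated (comm_subgroup [set x | phi x = 1] setT
    `|` [set` [seq pres_word set0 r.1 / pres_word set0 r.2 | r <- R]]).
Proof.
move=> [gR _ ginj]; set K := [set x | phi x = 1]; set J := generated _.
have phiE w : phi (pres_word set0 w) = word_eval (phi \o pres_gen set0) w.
  by rewrite pres_word_eval word_eval_mult.
have sK : is_subgroup K := kernel_subgroup phi.
have nK : normal_set K by move=> x y; rewrite /K /= multJ => ->; apply: conj1g.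
have sJ : is_subgroup J := generated_subgroup _.
have JK : J `<=` K.
  apply: generated_sub => // x [|/mapP[r Rr ->]]; first exact: comm_subgroup_sub.
  by rewrite /K /= multF !phiE gR // mulgV.
have nJ : normal_set J.
  move=> x y Jx; rewrite -[x ^ y](mulVKg x) -commgEl; apply: (subgroupM sJ Jx).
  by apply: sub_generated; left; apply: mem_comm; apply: JK.
have JM x y : J x -> J y -> J (x * y) by exact: (subgroupM sJ).
(* Induction on the congruence; concatenation uses that [J] is normal, as it lies between [[K, F]]
   and [K]. *)
have congJ u v : word_cong [set` R] u v -> J (pres_word set0 u / pres_word set0 v).
  elim=> {u v}.
  - by move=> u; rewrite mulgV; apply: (subgroup1 sJ).
  - by move=> u v _ uv; rewrite -invgF; apply: (subgroupV sJ).
  - by move=> u v w _ uv _ vw; rewrite -(divgKA (pres_word set0 v)); apply: JM.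
  - move=> u u' v v' _ uu' _ vv'; rewrite !pres_word_cat invgM mulgA.
    rewrite -(mulgA (pres_word _ u)).
    by rewrite (conjgCV (pres_word _ u)) -mulgA; apply: JM => //; apply: nJ.
  - move=> x e; have -> : pres_word set0 [:: (x, e); (x, ~~ e)] = pres_word set0 [::].
      by apply/pres_wordP; apply: WordCancel.
    by rewrite mulgV; apply: (subgroup1 sJ).
  - by move=> u v Ruv; apply: sub_generated; right; apply/mapP; exists (u, v).
apply/seteqP; split=> // x.
rewrite /K /= -[x]pres_reprK phiE => x1.
have /ginj/congJ : word_eval (phi \o pres_gen set0) (pres_repr x) =
    word_eval (phi \o pres_gen set0) [::] by rewrite x1 /word_eval big_nil.
by have -> : pres_word set0 [::] = 1 :> free 'I_n by []; rewrite invg1 mulg1.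
Qed.

Lemma fp_nfold_ker_fingen (G : groupType) n :
  finitely_presented G -> fingen (xm_ker (nfold_xm G n.+1)).
Proof.
move=> /finitely_presentedP[r [R [g gP]]].
pose f : free 'I_r -> G := pres_lift g.
have f0 q : @set0 (word 'I_r * word 'I_r) q -> word_eval g q.1 = word_eval g q.2 by [].
pose phi : {multiplicative free 'I_r -> G} :=
  HB.pack f (isMultiplicative.Build _ _ _ (pres_liftM f0)).
have phiE : phi \o pres_gen set0 = g.
  by apply: funext => i; apply: (pres_lift_gen f0).
rewrite -{}phiE in gP.
apply: (@nfold_ker_fingen _ _ phi _ n _ _ (free_generated r) (presentation_kernel gP)).
  have [_ gs _] := gP => x; have [w <-] := gs x.
  by exists (word_eval (pres_gen set0) w); rewrite word_eval_mult.
exact: free_nfold_ker_fingen.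
Qed.

Theorem theorem1p1 (n : nat) (hn : 2 <= n) (G : groupType)
    (fpG : finitely_presented G) :
  finitely_presented (nfold_tensor G n) <-> finitely_presented (gamma G n).
Proof.
case: n hn => [//|n] _; have kerF := fp_nfold_ker_fingen n fpG.
pose M := nfold_xm G n.+1; pose T := xm_car M.
have rangeE : range (xm_bd M) = @gamma_set G n.+1 by exact: range_nfold.
have bdP x : xm_bd M x \in @gamma_set G n.+1 by rewrite -rangeE; apply/mem_set; exists x.
(* The commutator map, corestricted to its range. *)
pose c x : gamma G n.+1 := exist _ (xm_bd M x) (bdP x).
have cM : {morph c : x y / x * y} by move=> x y; apply: val_inj; exact: gmulfM.
pose b : {multiplicative T -> gamma G n.+1} :=
  HB.pack c (isMultiplicative.Build _ _ _ cM).
have bsurj y : exists x, b x = y.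
  case: y => y yP; have : range (xm_bd M) y by rewrite rangeE; apply: set_mem.
  by move=> [x _ xy]; exists x; apply: val_inj.
have kerE : [set x | b x = 1] = xm_ker M.
  apply/seteqP; split=> x; first by move=> /(congr1 val).
  by move=> kx; apply: val_inj.
split=> [fpT|fpH].
  by apply: (finitely_presented_quotient (f := b)) => //; rewrite kerE.
apply: (@finitely_presented_central_extension T _ b) => //; first by rewrite kerE.
by move=> x y bx; apply: xm_kerC; rewrite -kerE.
Qed.
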